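(* Let $n\ge2$ and let $M^n$ be an $n$-dimensional Riemannian submanifold of a complex space form $\widetilde N^{2m}(4c)$ (real dimension $2m$, constant holomorphic sectional curvature $4c$, complex structure $J$) endowed with a semi-symmetric non-metric connection $\widetilde\nabla_XY=\mathring{\widetilde\nabla}_XY+\phi(Y)X$ associated with a $1$-form $\phi$. Then for every $x\in M^n$ and every unit vector $X\in T_xM^n$, $$\operatorname{Ric}(X)\ \ge\ (n-1)c+3c\|TX\|^2-\lambda+s(X,X)-n\,\phi(H)+\widetilde g\bigl(P^\perp,\sigma(X,X)\bigr)+\mathcal H(H,\sigma),$$ where $TX$ is the tangential part of $JX$ and $$\mathcal H(H,\sigma)=\frac{n-1}{n}\left(2n\|H\|^2-\|\sigma\|^2-(n-2)\|H\|\sqrt{\frac{n\left(\|\sigma\|^2-n\|H\|^2\right)}{n-1}}\right).$$ For $n\ge3$, equality holds at $x$ (for the vector $X$) if and only if both of the following hold: (i) in an orthonormal frame $\{e_1=X,e_2,\dots,e_n\}$ of $T_xM^n$, for each $\alpha\in\{n+1,\dots,2m\}$ the matrix $(\sigma^\alpha_{ij})_{1\le i,j\le n}$ equals $\operatorname{diag}(\lambda_\alpha,\mu_\alpha,\dots,\mu_\alpha)$ with $$\lambda_\alpha=H^\alpha-\frac{n-1}{n}\,\varepsilon_\alpha\sqrt{\frac{n\|\sigma^\alpha\|^2-n^2(H^\alpha)^2}{n-1}},\qquad \mu_\alpha=H^\alpha+\frac1n\,\varepsilon_\alpha\sqrt{\frac{n\|\sigma^\alpha\|^2-n^2(H^\alpha)^2}{n-1}},$$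 where $\varepsilon_\alpha=\operatorname{sgn}(H^\alpha)$ if $H^\alpha\ne0$, and $\varepsilon_\alpha\in\{+1,-1\}$ (either choice) if $H^\alpha=0$; (ii) writing $D_\alpha:=|\lambda_\alpha-\mu_\alpha|=\sqrt{\frac{n(\|\sigma^\alpha\|^2-n(H^\alpha)^2)}{n-1}}$, if $H\neq0$ at $x$ then there exists $\rho\ge0$ such that $D_\alpha=\rho\,|H^\alpha|$ for all $\alpha$.
   Context: Setting and notation. $\mathring{\widetilde\nabla}$ is the Levi-Civita connection of the ambient metric $\widetilde g$ and $\mathring{\widetilde R}$ its curvature. Curvature convention: $R(X,Y)Z=\nabla_X\nabla_YZ-\nabla_Y\nabla_XZ-\nabla_{[X,Y]}Z$, $R(X,Y,Z,W)=g(R(X,Y)Z,W)$. A complex space form $\widetilde N^{2m}(4c)$ is a Kähler manifold with complex structure $J$ and $$\mathring{\widetilde R}(X,Y,Z,W)=c\bigl[\widetilde g(X,W)\widetilde g(Y,Z)-\widetilde g(X,Z)\widetilde g(Y,W)+\widetilde g(JX,W)\widetilde g(JY,Z)-\widetilde g(JX,Z)\widetilde g(JY,W)-2\widetilde g(JX,Y)\widetilde g(JZ,W)\bigr].$$ For $X$ tangent to $M$, write $JX=TX+FX$ with $TX$ tangential and $FX$ normal; $\|TX\|^2=\sum_{k=1}^n\widetilde g(JX,e_k)^2$. For a $1$-form $\phi$ on $\widetilde N$, the (Agashe–Chafle) semi-symmetric non-metric connection is $\widetilde\nabla_XY=\mathring{\widetilde\nabla}_XY+\phi(Y)X$. The vector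 field $P$ is defined by $\widetilde g(P,X)=\phi(X)$; along $M^n$ write $P=P^\top+P^\perp$ (tangential and normal parts). The $(0,2)$-tensor $s$ on $\widetilde N$ is $s(X,Y)=(\mathring{\widetilde\nabla}_X\phi)(Y)-\phi(X)\phi(Y)$. $M^n$ carries the induced metric. The induced connection $\nabla$ and second fundamental form $\sigma$ are defined by $\widetilde\nabla_XY=\nabla_XY+\sigma(X,Y)$ (tangential plus normal part) for $X,Y$ tangent to $M$; $\sigma$ coincides with the usual Levi-Civita second fundamental form. $R$ denotes the curvature tensor of the induced connection $\nabla$ on $M$. Given orthonormal frames $\{e_1,\dots,e_n\}$ of $T_xM$ and $\{e_{n+1},\dots,e_{2m}\}$ of the normal space $T^\perp_xM$: $\sigma^\alpha_{ij}=\widetilde g(\sigma(e_i,e_j),e_\alpha)$, $\|\sigma^\alpha\|^2=\sum_{i,j}(\sigma^\alpha_{ij})^2$, $\|\sigma\|^2=\sum_\alpha\|\sigma^\alpha\|^2$, $H=\frac1n\sum_i\sigma(e_i,e_i)$, $H^\alpha=\frac1n\sum_i\sigma^\alpha_{ii}$, $\lambda=\sum_{i=1}^n s(e_i,e_i)$ (trace of $s$ over $T_xM$; not to be confused with the eigenvalues $\lambda_\alpha$), and $\phi(H)=\widetilde g(P^\perp,H)$. Convention for the Ricci curvature: for a unit $X=e_1$ completed to an orthonormal basis of $T_xM$, $\operatorname{Ric}(X):=\sum_{j=2}^nR(X,e_j,e_j,X)$. *)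

(* Defs.v *)
From HB Require Import structures.
From mathcomp Require Import all_boot all_order all_algebra.
From mathcomp Require Import all_classical all_reals all_analysis.

Set Implicit Arguments.
Unset Strict Implicit.
Unset Printing Implicit Defensive.

Import Order.TTheory GRing.Theory Num.Theory.
Import numFieldNormedType.Exports.

Local Open Scope classical_set_scope.
Local Open Scope ring_scope.

(** C^k and C^oo functions on an open set [U]. *)

Fixpoint Ck (k : nat) (R : realType) (d : nat) (W : normedModType R)
    (U : set 'rV[R]_d) (F : 'rV[R]_d -> W) : Prop :=
  match k with
  | 0 => forall p, U p -> {for p, continuous F}
  | k'.+1 => (forall p, U p -> differentiable F p) /\
             (forall v, Ck k' U (fun p => 'D_v F p))
  end.

Definition smooth_on (R : realType) (d : nat) (W : normedModType R)
    (U : set 'rV[R]_d) (F : 'rV[R]_d -> W) : Prop :=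
  forall k, Ck k U F.

(** A smooth manifold without boundary, given by a smooth atlas.  The inverse
    [mparam i] of the chart [mcoord i] is a total function whose values outside
    [mcoord i @` mdom i] are irrelevant. *)

Record manifold (R : realType) (d : nat) := Manifold {
  mpoint :> topologicalType;
  mchart : Type;
  mdom : mchart -> set mpoint;
  mcoord : mchart -> mpoint -> 'rV[R]_d;
  mparam : mchart -> 'rV[R]_d -> mpoint;
  m_hausdorff : hausdorff_space mpoint;
  m_countable : @second_countable mpoint;
  m_cover : forall x, exists i, mdom i x;
  m_dom_open : forall i, open (mdom i);
  m_range_open : forall i, open (mcoord i @` mdom i);
  m_coordK : forall i x, mdom i x -> mparam i (mcoord i x) = x;
  m_coord_cont : forall i x, mdom i x -> {for x, continuous (mcoord i)};
  m_param_cont : forall i p, (mcoord i @` mdom i) p ->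
    {for p, continuous (mparam i)};
  m_smooth : forall i j,
    smooth_on (mcoord i @` (mdom i `&` mdom j)) (mcoord j \o mparam i)
}.

Section Tensors.
Context {R : realType} {d : nat} (N : manifold R d).
Local Notation E := 'rV[R]_d.

Definition mrange (i : mchart N) : set E := mcoord i @` mdom i.
Definition overlap (i j : mchart N) : set E := mcoord i @` (mdom i `&` mdom j).
Definition transition (i j : mchart N) : E -> E := mcoord j \o mparam i.

(** Tensor fields and connections are families of components, one for each
    chart.  A tangent vector at [x] is written in the chart [i] as an element
    of [E]; the components in a chart take the base point [mcoord i x] as first
    argument. *)

Definition form1 := mchart N -> E -> E -> R.
Definition form2 := mchart N -> E -> E -> E -> R.
Definition endo := mchart N -> E -> E -> E.
Definition vfield := mchart N -> E -> E.

(** [G i p u v] is the vector with k-th coordinate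
    sum_{a,b} Gamma^k_{ab}(p) u_a v_b. *)
Definition christoffel := mchart N -> E -> E -> E -> E.

Definition is_metric (g : form2) : Prop :=
  [/\ forall i p u, mrange i p -> scalar (g i p u),
      forall i p u v, mrange i p -> g i p u v = g i p v u,
      forall i p u, mrange i p -> u != 0 -> 0 < g i p u u,
      forall i u v, smooth_on (mrange i) (fun p => g i p u v) &
      forall i j p u v, overlap i j p ->
        g i p u v = g j (transition i j p) ('D_u (transition i j) p)
                                           ('D_v (transition i j) p)].

Definition is_form1 (phi : form1) : Prop :=
  [/\ forall i p, mrange i p -> scalar (phi i p),
      forall i u, smooth_on (mrange i) (fun p => phi i p u) &
      forall i j p u, overlap i j p ->
        phi i p u = phi j (transition i j p) ('D_u (transition i j) p)].

Definition is_endo (J : endo) : Prop :=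
  [/\ forall i p, mrange i p -> linear (J i p),
      forall i u, smooth_on (mrange i) (fun p => J i p u) &
      forall i j p u, overlap i j p ->
        'D_(J i p u) (transition i j) p =
        J j (transition i j p) ('D_u (transition i j) p)].

End Tensors.

(** Covariant derivatives and curvature of a connection on an open set of R^d,
    and the pullback of a connection along a map F between open sets. *)

Section LocalConnection.
Context {R : realType} {d : nat}.
Local Notation E := 'rV[R]_d.
Implicit Types X Y Z : E -> E.

Definition bracket X Y : E -> E := fun p => 'D_(X p) Y p - 'D_(Y p) X p.

Definition nabla (G : E -> E -> E -> E) X Y : E -> E :=
  fun p => 'D_(X p) Y p + G p (X p) (Y p).

Definition nabla_along (d' : nat)
    (G : 'rV[R]_d' -> 'rV[R]_d' -> 'rV[R]_d' -> 'rV[R]_d')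
    (F : E -> 'rV[R]_d') X (V : E -> 'rV[R]_d') : E -> 'rV[R]_d' :=
  fun p => 'D_(X p) V p + G (F p) ('D_(X p) F p) (V p).

Definition curv_field (G : E -> E -> E -> E) X Y Z : E -> E :=
  fun p => nabla G X (nabla G Y Z) p - nabla G Y (nabla G X Z) p
           - nabla G (bracket X Y) Z p.

(** The curvature is tensorial, so its value on vectors is computed on the
    extensions which are constant in the chart. *)
Definition curv (G : E -> E -> E -> E) (p u v w : E) : E :=
  curv_field G (cst u) (cst v) (cst w) p.

End LocalConnection.

Section Connections.
Context {R : realType} {d : nat} {N : manifold R d}.
Local Notation E := 'rV[R]_d.

Definition is_connection (G : christoffel N) : Prop :=
  [/\ forall i p u, mrange i p -> linear (G i p u),
      forall i p v, mrange i p -> linear (fun u => G i p u v),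
      forall i u v, smooth_on (mrange i) (fun p => G i p u v) &
      forall i j p u v, overlap i j p ->
        'D_(nabla (G i) (cst u) (cst v) p) (transition i j) p =
        nabla_along (G j) (transition i j) (cst u)
          (fun q => 'D_v (transition i j) q) p].

Definition torsion_free (G : christoffel N) : Prop :=
  forall i (X Y : E -> E) p,
    smooth_on (mrange i) X -> smooth_on (mrange i) Y -> mrange i p ->
    nabla (G i) X Y p - nabla (G i) Y X p = bracket X Y p.

Definition metric_compatible (g : form2 N) (G : christoffel N) : Prop :=
  forall i (X Y Z : E -> E) p,
    smooth_on (mrange i) X -> smooth_on (mrange i) Y ->
    smooth_on (mrange i) Z -> mrange i p ->
    'D_(X p) (fun q => g i q (Y q) (Z q)) p =
    g i p (nabla (G i) X Y p) (Z p) + g i p (Y p) (nabla (G i) X Z p).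

Definition is_levi_civita (g : form2 N) (G : christoffel N) : Prop :=
  [/\ is_connection G, torsion_free G & metric_compatible g G].

Definition Riem (g : form2 N) (G : christoffel N) (i : mchart N)
    (p u v w z : E) : R :=
  g i p (curv (G i) p u v w) z.

(** [G] is meant to be the Levi-Civita connection of [g]. *)
Definition is_kahler (g : form2 N) (G : christoffel N) (J : endo N) : Prop :=
  [/\ is_endo J,
      forall i p u, mrange i p -> J i p (J i p u) = - u,
      forall i p u v, mrange i p -> g i p (J i p u) (J i p v) = g i p u v &
      forall i (X Y : E -> E) p,
        smooth_on (mrange i) X -> smooth_on (mrange i) Y -> mrange i p ->
        nabla (G i) X (fun q => J i q (Y q)) p = J i p (nabla (G i) X Y p)].

(** Constant holomorphic sectional curvature [4 * c]. *)
Definition is_complex_space_form (g : form2 N) (G : christoffel N)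
    (J : endo N) (c : R) : Prop :=
  is_kahler g G J /\
  forall i p u v w z, mrange i p ->
    Riem g G i p u v w z =
    c * (g i p u z * g i p v w - g i p u w * g i p v z
         + g i p (J i p u) z * g i p (J i p v) w
         - g i p (J i p u) w * g i p (J i p v) z
         - 2 * g i p (J i p u) v * g i p (J i p w) z).

(** nabla~_X Y = nabla_X Y + phi(Y) X *)
Definition semi_symmetric (G : christoffel N) (phi : form1 N) :
    christoffel N :=
  fun i p u v => G i p u v + phi i p v *: u.

Definition is_dual_field (g : form2 N) (phi : form1 N) (P : vfield N) : Prop :=
  forall i p u, mrange i p -> g i p (P i p) u = phi i p u.

(** s(X,Y) = (nabla_X phi)(Y) - phi(X) phi(Y), with X and Y constant in the
    chart. *)
Definition s_tensor (G : christoffel N) (phi : form1 N) : form2 N :=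
  fun i p u v =>
    ('D_u (fun q => phi i q v) p - phi i p (nabla (G i) (cst u) (cst v) p))
    - phi i p u * phi i p v.

End Connections.

Section Submanifolds.
Context {R : realType} {n d : nat} {M : manifold R n} {N : manifold R d}.
Variable f : M -> N.

Definition lrep (i : mchart M) (a : mchart N) : 'rV[R]_n -> 'rV[R]_d :=
  mcoord a \o f \o mparam i.

Definition lrep_dom (i : mchart M) (a : mchart N) : set 'rV[R]_n :=
  mcoord i @` (mdom i `&` f @^-1` mdom a).

Definition is_immersion : Prop :=
  [/\ continuous f,
      forall i a, smooth_on (lrep_dom i a) (lrep i a) &
      forall i a p u, lrep_dom i a p -> 'D_u (lrep i a) p = 0 -> u = 0].

Definition is_isometric (gM : form2 M) (g : form2 N) : Prop :=
  forall i a p u v, lrep_dom i a p ->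
    gM i p u v = g a (lrep i a p) ('D_u (lrep i a) p) ('D_v (lrep i a) p).

(** nabla~_X (f_* Y) - f_* (nabla_X Y), where nabla~ is the connection [Gt] on
    the ambient manifold and nabla the connection [G] on the submanifold. *)
Definition second_ff_field (Gt : christoffel N) (G : christoffel M)
    (i : mchart M) (a : mchart N) (X Y : 'rV[R]_n -> 'rV[R]_n) :
    'rV[R]_n -> 'rV[R]_d :=
  fun p => nabla_along (Gt a) (lrep i a) X (fun q => 'D_(Y q) (lrep i a) q) p
           - 'D_(nabla (G i) X Y p) (lrep i a) p.

Definition second_ff (Gt : christoffel N) (G : christoffel M)
    (i : mchart M) (a : mchart N) (p u v : 'rV[R]_n) : 'rV[R]_d :=
  second_ff_field Gt G i a (cst u) (cst v) p.

(** [G] is the tangential part of [Gt], i.e. the difference above is normal. *)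
Definition is_induced_connection (g : form2 N) (Gt : christoffel N)
    (G : christoffel M) : Prop :=
  is_connection G /\
  forall i a (X Y : 'rV[R]_n -> 'rV[R]_n) p w,
    smooth_on (mrange i) X -> smooth_on (mrange i) Y -> lrep_dom i a p ->
    g a (lrep i a p) (second_ff_field Gt G i a X Y p) ('D_w (lrep i a) p) = 0.

End Submanifolds.

(** Pointwise notions.  Indices of frames start at 0, so that e_1 is
    [e (first hn)]. *)

Definition first (n : nat) (hn : (2 <= n)%N) : 'I_n := Ordinal (ltnW hn).

Section Pointwise.
Context {R : realType} {n d : nat}.

Definition orthonormal_family (k l : nat) (g : 'rV[R]_l -> 'rV[R]_l -> R)
    (e : 'I_k -> 'rV[R]_l) : Prop :=
  forall i j, g (e i) (e j) = (i == j)%:R.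

Definition ricci (gx : 'rV[R]_n -> 'rV[R]_n -> R)
    (Rx : 'rV[R]_n -> 'rV[R]_n -> 'rV[R]_n -> 'rV[R]_n)
    (e : 'I_n -> 'rV[R]_n) (i0 : 'I_n) : R :=
  \sum_(j | j != i0) gx (Rx (e i0) (e j) (e j)) (e i0).

Definition mean_curvature (sigma : 'rV[R]_n -> 'rV[R]_n -> 'rV[R]_d)
    (e : 'I_n -> 'rV[R]_n) : 'rV[R]_d :=
  n%:R^-1 *: \sum_i sigma (e i) (e i).

Definition sigma_mx (g : 'rV[R]_d -> 'rV[R]_d -> R)
    (sigma : 'rV[R]_n -> 'rV[R]_n -> 'rV[R]_d)
    (e : 'I_n -> 'rV[R]_n) (nu : 'rV[R]_d) : 'M[R]_n :=
  \matrix_(i, j) g (sigma (e i) (e j)) nu.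

Definition sqnorm_mx (A : 'M[R]_n) : R := \sum_i \sum_j A i j ^+ 2.

Definition Halpha (A : 'M[R]_n) : R := n%:R^-1 * \sum_i A i i.

(** The two square roots in the statement, which agree: the one in
    lambda_alpha and mu_alpha, and D_alpha = |lambda_alpha - mu_alpha|. *)
Definition root_alpha (A : 'M[R]_n) : R :=
  Num.sqrt ((n%:R * sqnorm_mx A - n%:R ^+ 2 * Halpha A ^+ 2) / (n%:R - 1)).

Definition Dalpha (A : 'M[R]_n) : R :=
  Num.sqrt (n%:R * (sqnorm_mx A - n%:R * Halpha A ^+ 2) / (n%:R - 1)).

Definition lambda_alpha (eps : R) (A : 'M[R]_n) : R :=
  Halpha A - (n%:R - 1) / n%:R * eps * root_alpha A.

Definition mu_alpha (eps : R) (A : 'M[R]_n) : R :=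
  Halpha A + n%:R^-1 * eps * root_alpha A.

Definition admissible_sign (h eps : R) : Prop :=
  if h == 0 then eps = 1 \/ eps = -1 else eps = Num.sg h.

(** [normH] is the norm of H and [sqnorm_sigma] the squared norm of sigma. *)
Definition calH (normH sqnorm_sigma : R) : R :=
  (n%:R - 1) / n%:R *
  (2 * n%:R * normH ^+ 2 - sqnorm_sigma
   - (n%:R - 2) * normH *
     Num.sqrt (n%:R * (sqnorm_sigma - n%:R * normH ^+ 2) / (n%:R - 1))).

End Pointwise.

(* Main.v *)
Require Import Defs.
From HB Require Import structures.
From mathcomp Require Import all_boot all_order all_algebra.
From mathcomp Require Import all_classical all_reals all_analysis.
From mathcomp Require Import ring lra.

Set Implicit Arguments.
Unset Strict Implicit.
Unset Printing Implicit Defensive.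

Import Order.TTheory GRing.Theory Num.Theory.
Import numFieldNormedType.Exports.

Local Open Scope classical_set_scope.
Local Open Scope ring_scope.

(** The inequality is the Gauss equation followed by an optimization over
    symmetric matrices.

    The Gauss equation.  Write U, V, W, Z for the images of u, v, w, z under
    the differential of the immersion F.  Differentiating the splitting
    nabla~_V W = dF (D_v w) + sigma(v, w) once more along U, antisymmetrizing
    in u and v and pairing with Z gives [gauss_equation].  Mixed second
    derivatives of F and of its directional derivatives commute
    ([derive_comm]), so only the ambient curvature is left on one side; on the
    other, the derivative of sigma(v, w) is paired with a tangent vector, and
    differentiating the identity g (sigma(v, w)) Z = 0 turns it into
    - g (sigma(v, w)) (sigma(u, z)) plus phi (sigma(v, w)) g(U, Z)
    ([cov_sff_tangent]).  The last term is the failure of the semi-symmetric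
    connection to be metric.  Its curvature differs from that of the
    Levi-Civita connection by s(u, w) v - s(v, w) u ([curv_semi_symmetric]).

    The trace.  Taking u = z = e_1, v = w = e_j and summing over j > 1, every
    term but the quadratic one in sigma is explicit in a complex space form.
    Normal vectors are expanded in the normal frame ([normal_parseval]), which
    turns the quadratic term into the sum over alpha of
    sum_(j > 1) (A_11 A_jj - A_1j ^ 2), with A the matrix of sigma^alpha
    ([ricci_decomposition]).

    One matrix.  Fix a symmetric matrix A with mean diagonal entry h and
    squared norm S, put b = A_11 - h and D = [Dalpha A].  Splitting S into the
    first entry, the first row, the mean of the remaining diagonal and a
    remainder r >= 0 shows that the quadratic term exceeds its bound by
    (n-2) (b h + (n-1)/n |h| D) + (n-2)/n q + (n-1)/n r,
    where q is the squared norm of the rest of the first row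
    ([ricci_mx_excess]).  The same splitting gives |b| <= (n-1)/n D, so all
    three summands are nonnegative; for n >= 3 they all vanish exactly when A
    is diagonal, its diagonal is constant past the first entry, and b has the
    sign opposite to that of h, or any sign if h = 0 ([ricci_mx_eq]).

    All matrices.  The sum of the bounds for the A's exceeds the bound for
    their total by a multiple of the defect of the Cauchy-Schwarz inequality
    for the families |h_alpha| and D_alpha, whose equality case is the
    proportionality condition ([sum_ricci_mx_eq]). *)

(** * Product rules and mixed derivatives *)

Lemma is_derive_val (R : numFieldType) (V W : normedModType R) (f : V -> W)
    (x v : V) (l : W) : is_derive x v f l -> 'D_v f x = l.
Proof. by case. Qed.

Lemma is_derive_derivable (R : numFieldType) (V W : normedModType R) (f : V -> W)
    (x v : V) (l : W) : is_derive x v f l -> derivable f x v.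
Proof. by case. Qed.

Section ProductRule.
Context {R : realType} {V : normedModType R}.

Lemma is_derive_scale (W : normedModType R) (f : V -> R) (g : V -> W) (x v : V) :
  derivable f x v -> derivable g x v ->
  is_derive x v (fun q => f q *: g q) (f x *: 'D_v g x + 'D_v f x *: g x).
Proof.
move=> df dg.
suff h : (fun h => h^-1 *: (((fun q => f q *: g q) \o shift x) (h *: v) - f x *: g x))
    @ 0^' --> f x *: 'D_v g x + 'D_v f x *: g x.
  by split; [apply/cvg_ex; eexists; exact: h | exact: cvg_lim h].
have -> : (fun h => h^-1 *: (((fun q => f q *: g q) \o shift x) (h *: v) - f x *: g x))
   = (fun h => f (h *: v + x) *: (h^-1 *: (g (h *: v + x) - g x))
               + (h^-1 *: (f (h *: v + x) - f x)) *: g x).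
  apply/funext => h /=.
  have key (c a b : R) (y z : W) :
      c *: (a *: y - b *: z) = a *: (c *: (y - z)) + (c * (a - b)) *: z.
    rewrite !scalerA [a * c]mulrC -!scalerA -scalerDr; congr (_ *: _).
    by rewrite scalerBr scalerBl addrA subrK.
  exact: key.
apply: cvgD; last first.
  by apply: cvgZr_tmp; exact: df.
apply: cvgZ; last exact: dg.
suff : {for 0, continuous (fun h : R => f(h *: v + x))}.
  by move=> /continuous_withinNx; rewrite scale0r add0r.
exact/differentiable_continuous/derivable1_diffP/(derivable1P _ _ _).1.
Qed.

(** A linear map T q that depends on the point is applied to a moving vector
    A q: expanding A q in coordinates makes this a finite sum of products.
    Linearity is only asked near x because the components of a tensor
    in a chart are unconstrained outside the range of the chart. *)
Lemma is_derive_eval (k : nat) (W : normedModType R) (T : V -> 'rV[R]_k -> W)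
    (A : V -> 'rV[R]_k) (x v : V) :
    (\forall q \near x, linear (T q)) ->
    (forall w, derivable (T ^~ w) x v) -> derivable A x v ->
  is_derive x v (fun q => T q (A q)) ('D_v (T ^~ (A x)) x + T x ('D_v A x)).
Proof.
move=> Tlin dT dA.
pose E (j : 'I_k) : 'rV[R]_k := delta_mx 0 j.
have Texp q : linear (T q) -> forall w, T q w = \sum_j w 0 j *: T q (E j).
  move=> lT w; pose L := GRing.isLinear.Build _ _ _ _ (T q) lT.
  pose TL : {linear 'rV[R]_k -> W} := HB.pack (T q) L.
  rewrite -[T q]/(TL : _ -> _) [in LHS](row_sum_delta w) linear_sum.
  by apply: eq_bigr => j _; rewrite linearZ.
have dE (B : V -> 'rV[R]_k) : derivable B x v ->
    is_derive x v (fun q => \sum_j B q 0 j *: T q (E j))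
      (\sum_j (B x 0 j *: 'D_v (T ^~ (E j)) x + 'D_v B x 0 j *: T x (E j))).
  move=> dB.
  have -> : (fun q => \sum_j B q 0 j *: T q (E j)) =
     \sum_j (fun q => B q 0 j *: T q (E j)).
    by apply/funext => q; rewrite fct_sumE.
  apply: is_derive_sum => j; rewrite derive_mx // mxE.
  apply: is_derive_scale; last exact: dT.
  by move/derivable_mxP: dB; exact.
have near_expand (B : V -> 'rV[R]_k) :
    {near x, (fun q => \sum_j B q 0 j *: T q (E j)) =1 (fun q => T q (B q))}.
  by near=> q; rewrite /= -Texp //; near: q.
apply: (near_eq_is_derive (near_expand A)).
apply: is_derive_eq (dE _ dA) _.
rewrite big_split /= -(Texp _ (nbhs_singleton Tlin)); congr (_ + _).
rewrite -(near_eq_derive _ (near_expand (cst (A x)))).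
rewrite (is_derive_val (dE _ (derivable_cst (A x) x v))).
apply: eq_bigr => j _.
by rewrite derive_cst mxE scale0r addr0.
Unshelve. all: by end_near. Qed.

End ProductRule.

Lemma is_derive_chain (R : realType) (k l : nat) (W : normedModType R)
    (F : 'rV[R]_k -> 'rV[R]_l) (B : 'rV[R]_l -> W) x v :
    differentiable F x -> differentiable B (F x) ->
  is_derive x v (B \o F) ('D_('D_v F x) B (F x)).
Proof.
move=> dF dB; have dBF : differentiable (B \o F) x by exact: differentiable_comp.
apply: DeriveDef; first exact: diff_derivable.
by rewrite !deriveE // diff_comp.
Qed.

Section MixedDerivatives.
Context {R : realType} {k : nat}.
Local Notation E := 'rV[R]_k.

Lemma is_derive_line (G : E -> R) (a u : E) (s : R) :
  derivable G (a + s *: u) u ->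
  is_derive s 1 (fun r : R => G (a + r *: u)) ('D_u G (a + s *: u)).
Proof.
have hE : (fun h => h^-1 *: (((fun r : R => G (a + r *: u)) \o shift s) (h *: 1)
      - G (a + s *: u))) =
   (fun h => h^-1 *: ((G \o shift (a + s *: u)) (h *: u) - G (a + s *: u))).
  apply/funext => h /=; congr (_ *: (G _ - _)).
  by rewrite [h *: 1]mulr1 scalerDl addrCA.
by move=> dG; split; rewrite /derivable /derive hE.
Qed.

Lemma mvt_line (G : E -> R) (a u : E) (t : R) : 0 <= t ->
    (forall s, 0 <= s <= t -> derivable G (a + s *: u) u) ->
  exists2 s, 0 <= s <= t & G (a + t *: u) - G a = t * 'D_u G (a + s *: u).
Proof.
move=> t0 dG.
have [|| s] := @MVT_segment R (fun r : R => G (a + r *: u))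
   (fun r => 'D_u G (a + r *: u)) 0 t t0.
- move=> s; rewrite in_itv /= => /andP[s0 st].
  by apply/is_derive_line/dG; rewrite !ltW.
- apply: derivable_within_continuous => s; rewrite in_itv /= => st.
  by apply: is_derive_derivable; exact/is_derive_line/dG.
rewrite in_itv /= => st; rewrite scale0r addr0 subr0 mulrC => h.
by exists s.
Qed.

(** The mean value theorem twice: in the direction u for the increment of G
    along v, then in the direction v for the derivative of G along u. *)
Lemma mvt_square (G : E -> R) (a u v : E) (t : R) : 0 <= t ->
    (forall s r, 0 <= s <= t -> 0 <= r <= t ->
       derivable G (a + s *: u + r *: v) u) ->
    (forall s r, 0 <= s <= t -> 0 <= r <= t ->
       derivable ('D_u G) (a + s *: u + r *: v) v) ->
  exists s r, [/\ 0 <= s <= t, 0 <= r <= t &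
    G (a + t *: u + t *: v) - G (a + t *: u) - (G (a + t *: v) - G a) =
    t ^+ 2 * 'D_v ('D_u G) (a + s *: u + r *: v)].
Proof.
move=> t0 dG ddG.
have tt : 0 <= t <= t by rewrite t0 lexx.
have t00 : 0 <= (0 : R) <= t by rewrite t0 lexx.
pose G' x := G (x + t *: v) - G x.
have dshift w s : 0 <= s <= t ->
    is_derive (a + s *: u) u (fun x => G (x + t *: v)) ('D_u G (a + s *: u + t *: v)).
  move=> st; have d := dG _ _ st tt; split; rewrite /derivable /derive;
  have -> : (fun h => h^-1 *: (((fun x => G (x + t *: v)) \o shift (a + s *: u)) (h *: u)
      - G (a + s *: u + t *: v))) =
   (fun h => h^-1 *: ((G \o shift (a + s *: u + t *: v)) (h *: u) - G (a + s *: u + t *: v)))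
   by apply/funext => h /=; rewrite !addrA.
  - exact: d.
  - by [].
have dG' s : 0 <= s <= t -> is_derive (a + s *: u) u G'
    ('D_u G (a + s *: u + t *: v) - 'D_u G (a + s *: u)).
  move=> st; apply: is_deriveB; first exact: dshift.
  by apply: derivableP; have := dG s 0 st t00; rewrite scale0r addr0.
have [s st sE] := mvt_line t0 (fun s st => is_derive_derivable (dG' s st)).
have [r rt rE] := mvt_line t0 (fun r rt => ddG s r st rt).
exists s, r; split=> //.
rewrite -[LHS]/(G' (a + t *: u) - G' a) sE.
by rewrite (is_derive_val (dG' s st)) rE mulrA -expr2.
Qed.

(** The second difference of G over a small parallelogram is symmetric in u
    and v, and [mvt_square] identifies it with t ^ 2 times either mixed
    derivative at some point of the parallelogram. *)
Lemma derive_comm_real (G : E -> R) (a u v : E) :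
    (\forall x \near a, derivable G x u /\ derivable G x v) ->
    (\forall x \near a, derivable ('D_u G) x v /\ derivable ('D_v G) x u) ->
    {for a, continuous ('D_v ('D_u G))} -> {for a, continuous ('D_u ('D_v G))} ->
  'D_v ('D_u G) a = 'D_u ('D_v G) a.
Proof.
move=> dG dGw cvu cuv; apply/eqP; rewrite -subr_eq0 -normr_le0.
apply/ler_addgt0Pl => e e0; rewrite addr0.
have e20 : 0 < e / 2 by rewrite divr_gt0.
have near_all : \forall x \near a, [/\ derivable G x u /\ derivable G x v,
   derivable ('D_u G) x v /\ derivable ('D_v G) x u & `|'D_v ('D_u G) a - 'D_v ('D_u G) x| < e / 2 /\
   `|'D_u ('D_v G) a - 'D_u ('D_v G) x| < e / 2].
  move/cvgrPdist_lt : cvu => /(_ _ e20) h1.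
  move/cvgrPdist_lt : cuv => /(_ _ e20) h2.
  have near_conj (P Q S : E -> Prop) : (forall x, P x -> Q x -> S x) ->
      (\forall x \near a, P x) -> (\forall x \near a, Q x) ->
      \forall x \near a, S x.
    by move=> PQS hP hQ; near=> x; apply: PQS; near: x.
  apply: (near_conj _ _ _ _ dG); last first.
    apply: (near_conj _ _ _ _ dGw); last first.
      by apply: (near_conj _ _ _ _ h1 h2) => x; exact: conj.
    by move=> x; exact: conj.
  by move=> x ? [? ?]; split.
have [d /= d0 ball_all] := (nbhs_ballP _ _).1 near_all.
(* this t keeps the parallelogram inside the ball of radius d; the 1 only
   avoids dividing by 0 when u = v = 0 *)
pose t := d / 2 / (1 + `|u| + `|v|).
have C0 : 0 < 1 + `|u| + `|v| by rewrite -addrA ltr_pwDl ?addr_ge0.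
have t0 : 0 < t by rewrite !divr_gt0.
have inball s r : 0 <= s <= t -> 0 <= r <= t -> ball a d (a + s *: u + r *: v).
  move=> /andP[s0 st] /andP[r0 rt]; rewrite -ball_normE /ball_ /=.
  rewrite -addrA opprD addNKr normrN.
  rewrite (le_lt_trans (ler_normD _ _)) // !normrZ !ger0_norm //.
  apply: (@le_lt_trans _ _ (t * (1 + `|u| + `|v|))).
    rewrite -addrA mulrDr mulr1 mulrDr.
    by rewrite ler_wpDl ?(ltW t0) // lerD // ler_wpM2r.
  by rewrite /t divfK ?gt_eqF // ltr_pdivrMr // mulr_natr mulr2n ltrDr.
have [s [r [st rt E1]]] : exists s r, [/\ 0 <= s <= t, 0 <= r <= t &
    G (a + t *: u + t *: v) - G (a + t *: u) - (G (a + t *: v) - G a) =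
    t ^+ 2 * 'D_v ('D_u G) (a + s *: u + r *: v)].
  by apply: mvt_square (ltW t0) _ _ => s r st rt;
    have [[? _] [? _] _] := ball_all _ (inball _ _ st rt).
have inball' s' r' : 0 <= s' <= t -> 0 <= r' <= t -> ball a d (a + s' *: v + r' *: u).
  by move=> st' rt'; rewrite addrAC; exact: inball.
have [s' [r' [st' rt' E2]]] : exists s r, [/\ 0 <= s <= t, 0 <= r <= t &
    G (a + t *: v + t *: u) - G (a + t *: v) - (G (a + t *: u) - G a) =
    t ^+ 2 * 'D_u ('D_v G) (a + s *: v + r *: u)].
  by apply: mvt_square (ltW t0) _ _ => s' r' st' rt';
    have [[_ ?] [_ ?] _] := ball_all _ (inball' _ _ st' rt').
have E3 : 'D_v ('D_u G) (a + s *: u + r *: v) = 'D_u ('D_v G) (a + s' *: v + r' *: u).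
  have tn0 : t ^+ 2 != 0 by rewrite expf_eq0 /= gt_eqF.
  have swap (x y z w : R) : x - y - (z - w) = x - z - (y - w) by ring.
  apply: (mulfI tn0); apply: (etrans (esym E1)); apply: (etrans _ E2).
  by rewrite [a + t *: v + _]addrAC; exact: swap.
have [_ _ [h1 _]] := ball_all _ (inball _ _ st rt).
have [_ _ [_ h2]] := ball_all _ (inball' _ _ st' rt').
have tri (x y z : R) : `|x - y| < e / 2 -> `|z - y| < e / 2 -> `|x - z| <= e.
  move=> xy; rewrite distrC => zy.
  have -> : x - z = (x - y) + (y - z) by ring.
  apply: le_trans (ler_normD _ _) _; rewrite [leRHS]splitr.
  by apply: lerD; exact: ltW.
by rewrite E3 in h1; exact: tri h1 h2.
Unshelve. all: by end_near. Qed.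

(** Coordinate by coordinate.  The hypotheses are made on an open set because
    the identity between a derivative of F and those of its coordinates has to
    hold near each point in order to be differentiated once more. *)
Lemma derive_comm (l : nat) (U : set E) (F : E -> 'rV[R]_l) (a u v : E) :
    open U -> U a ->
    (forall x, U x -> differentiable F x) ->
    (forall w x, U x -> differentiable ('D_w F) x) ->
    (forall w z, {for a, continuous ('D_z ('D_w F))}) ->
  'D_v ('D_u F) a = 'D_u ('D_v F) a.
Proof.
move=> oU Ua dF ddF cF.
have near_eq (f g : E -> R) : {in U, f =1 g} -> forall x, U x -> \near x, f x = g x.
  move=> fg x Ux; have Unear : \forall y \near x, U y by exact: open_nbhs_nbhs.
  by near=> y; apply: fg; rewrite inE; near: y.
have coordE (H : E -> 'rV[R]_l) j w x : differentiable H x ->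
    'D_w (fun x => H x 0 j) x = 'D_w H x 0 j.
  by move=> dH; rewrite derive_mx ?mxE //; exact: diff_derivable.
have coord_der (H : E -> 'rV[R]_l) j w x : differentiable H x ->
    derivable (fun x => H x 0 j) x w.
  by move=> /(diff_derivable (v := w)) /derivable_mxP; exact.
have D1 j w : {in U, 'D_w (fun x => F x 0 j) =1 fun x => 'D_w F x 0 j}.
  by move=> x; rewrite inE => Ux; rewrite coordE //; exact: dF.
have D2 j w z : {in U, 'D_z ('D_w (fun x => F x 0 j)) =1 fun x => 'D_z ('D_w F) x 0 j}.
  move=> x; rewrite inE => Ux; rewrite -coordE; last exact: ddF.
  by apply: near_eq_derive; exact: near_eq.
have dD1 j w z x : U x -> derivable ('D_w (fun x => F x 0 j)) x z.
  move=> Ux; apply: (@near_eq_derivable _ _ _ (fun x => 'D_w F x 0 j)).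
    by apply: near_eq => // y Uy; rewrite D1.
  by apply: coord_der; exact: ddF.
have cD2 j w z : {for a, continuous ('D_z ('D_w (fun x => F x 0 j)))}.
  rewrite /prop_for /continuous_at D2 ?inE //.
  have cc : {for a, continuous ((fun M : 'rV[R]_l => M 0 j) \o 'D_z ('D_w F))}.
    exact: (continuous_comp (cF w z) (@coord_continuous _ _ _ 0 j _)).
  apply: (cvg_trans _ cc).
  have neq : {near nbhs a, (fun M : 'rV[R]_l => M 0 j) \o 'D_z ('D_w F)
      =1 'D_z ('D_w (fun x => F x 0 j))}.
    by apply: near_eq => // y Uy; rewrite D2.
  exact: (near_eq_cvg neq).
have aU : a \in U by rewrite inE.
apply/rowP => j; apply: (etrans (esym (D2 j u v a aU))).
apply: (etrans _ (D2 j v u a aU)).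
have Unear : \forall y \near a, U y by exact: open_nbhs_nbhs.
apply: derive_comm_real; last 2 first.
- exact: cD2.
- exact: cD2.
- by near=> x; split; apply: coord_der; apply: dF; near: x.
- by near=> x; split; apply: dD1; near: x.
Unshelve. all: by end_near. Qed.

End MixedDerivatives.

(** * The Gauss equation in coordinates *)

Section SmoothFacts.
Context {R : realType} {k : nat} {W : normedModType R}.
Variables (U : set 'rV[R]_k) (F : 'rV[R]_k -> W).
Hypothesis hF : smooth_on U F.

Lemma smooth_differentiable p : U p -> differentiable F p.
Proof. by move: p; exact: (hF 1).1. Qed.

Lemma smooth_derive u : smooth_on U ('D_u F).
Proof. by move=> j; exact: (hF j.+1).2. Qed.

Lemma smooth_continuous p : U p -> {for p, continuous F}.
Proof. by move: p; exact: (hF 0). Qed.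

End SmoothFacts.

Lemma smooth_cst (R : realType) (k : nat) (W : normedModType R)
    (U : set 'rV[R]_k) (w : W) : smooth_on U (cst w : 'rV[R]_k -> W).
Proof.
move=> j; elim: j w => [|j IH] w /=; first by move=> p _; exact: cst_continuous.
split=> [p _|v]; first exact: differentiable_cst.
have -> : (fun p => 'D_v (cst w : 'rV[R]_k -> W) p) = cst 0.
  by apply/funext => p; rewrite derive_cst.
exact: IH.
Qed.

Lemma derive_dir_linear (R : realType) (V W : normedModType R) (F : V -> W) p :
  differentiable F p -> linear (fun u => 'D_u F p).
Proof. by move=> dF a u v; rewrite !deriveE // linearP. Qed.

(** The components of tensors are linear only at the points of the range of a
    chart, so linearity comes as a hypothesis at a point and not as a bundled
    morphism. *)
Section LinearFacts.
Context {R : pzRingType} {V W : lmodType R}.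
Variable (f : V -> W).
Hypothesis lf : linear f.

Lemma linear_fun0 : f 0 = 0.
Proof. by have := lf (-1) 0 0; rewrite scaleN1r oppr0 addr0 scaleN1r addNr. Qed.

Lemma linear_funD u v : f (u + v) = f u + f v.
Proof. by have := lf 1 u v; rewrite !scale1r. Qed.

Lemma linear_funZ a u : f (a *: u) = a *: f u.
Proof. by have := lf a u 0; rewrite linear_fun0 !addr0. Qed.

Lemma linear_funN u : f (- u) = - f u.
Proof. by rewrite -scaleN1r linear_funZ scaleN1r. Qed.

Lemma linear_funB u v : f (u - v) = f u - f v.
Proof. by rewrite linear_funD linear_funN. Qed.

Lemma linear_fun_sum (I : finType) (F : I -> V) : f (\sum_i F i) = \sum_i f (F i).
Proof.
by apply: (big_morph f linear_funD linear_fun0).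
Qed.
End LinearFacts.

(** The bilinear version, by [is_derive_eval] in each argument in turn. *)
Lemma is_derive_eval2 (R : realType) (V W : normedModType R) (k l : nat)
    (T : V -> 'rV[R]_k -> 'rV[R]_l -> W) (A : V -> 'rV[R]_k) (B : V -> 'rV[R]_l)
    (x v : V) :
    (\forall q \near x, forall y, linear (T q y)) ->
    (\forall q \near x, forall z, linear (T q ^~ z)) ->
    (forall y z, derivable (fun q => T q y z) x v) ->
    derivable A x v -> derivable B x v ->
  is_derive x v (fun q => T q (A q) (B q))
    ('D_v (fun q => T q (A x) (B x)) x + T x ('D_v A x) (B x)
     + T x (A x) ('D_v B x)).
Proof.
move=> linr linl dT dA dB.
have inner z : is_derive x v (fun q => T q (A q) z)
    ('D_v (fun q => T q (A x) z) x + T x ('D_v A x) z).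
  apply: (is_derive_eval (T := fun q y => T q y z)) => //.
  by near=> q; near: q; apply: filterS linl => q; exact.
rewrite -(is_derive_val (inner (B x))).
apply: (is_derive_eval (T := fun q => T q (A q))) => //.
by near=> q; near: q; apply: filterS linr => q; exact.
Unshelve. all: by end_near. Qed.

Lemma curvE (R : realType) (d : nat) (G : 'rV[R]_d -> 'rV[R]_d -> 'rV[R]_d -> 'rV[R]_d)
    p u v w : (linear (fun x => G p x w)) ->
  curv G p u v w = 'D_u (fun q => G q v w) p + G p u (G p v w)
    - ('D_v (fun q => G q u w) p + G p v (G p u w)).
Proof.
move=> lG.
have nE x : nabla G (cst x) (cst w) = fun q => G q x w.
  by apply/funext => q; rewrite /nabla derive_cst add0r.
rewrite /curv /curv_field !nE /nabla /bracket !derive_cst subrr.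
by rewrite add0r (linear_fun0 lG) subr0.
Qed.

Section GaussEquation.
Context {R : realType} {n d : nat}.
(** [F] is an immersion read in charts, from [U] to [V], [G] the ambient
    connection, [Dc] the connection on the submanifold. *)
Variables (U : set 'rV[R]_n) (V : set 'rV[R]_d) (F : 'rV[R]_n -> 'rV[R]_d).
Hypotheses (oU : open U) (hF : smooth_on U F) (FU : forall p, U p -> V (F p)).
Variable G : 'rV[R]_d -> 'rV[R]_d -> 'rV[R]_d -> 'rV[R]_d.
Hypotheses (G_linr : forall q u, V q -> linear (G q u))
  (G_linl : forall q v, V q -> linear (G q ^~ v))
  (G_differentiable : forall q u v, V q -> differentiable (fun q => G q u v) q).

Variable Dc : 'rV[R]_n -> 'rV[R]_n -> 'rV[R]_n -> 'rV[R]_n.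
Hypotheses (Dc_linl : forall q v, U q -> linear (Dc q ^~ v))
  (Dc_differentiable : forall q u v, U q -> differentiable (fun q => Dc q u v) q).
(** The formula for the second fundamental form of [Dc] relative to [G] on
    fields constant in the chart; it is normal when [Dc] is the connection
    induced by [G]. *)
Definition sff u v p :=
  'D_u ('D_v F) p + G (F p) ('D_u F p) ('D_v F p) - 'D_(Dc p u v) F p.

Let nearU p : U p -> \forall q \near p, U q.
Proof. by move=> Up; exact: open_nbhs_nbhs. Qed.

Let dF p : U p -> differentiable F p.
Proof. exact: (smooth_differentiable hF). Qed.

Let ddF w p : U p -> differentiable ('D_w F) p.
Proof. apply: smooth_differentiable; exact: (smooth_derive hF). Qed.

Lemma derive_comm_smooth (l : nat) (H : 'rV[R]_n -> 'rV[R]_l) (u v p : 'rV[R]_n) :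
  smooth_on U H -> U p -> 'D_u ('D_v H) p = 'D_v ('D_u H) p.
Proof.
move=> hH Up; apply: (@derive_comm _ _ _ U H p v u oU Up).
- by move=> x; exact: (smooth_differentiable hH).
- by move=> w x; apply: smooth_differentiable; exact: smooth_derive.
- by move=> w z; apply: smooth_continuous Up; do 2!apply: smooth_derive.
Qed.

(** The ambient covariant derivative along u of the normal field
    sigma(v, w); likewise [cov_dF] is that of the tangent field dF w along v. *)
Definition cov_sff u v w p :=
  'D_u (sff v w) p + G (F p) ('D_u F p) (sff v w p).

Lemma is_derive_G_along (A C : 'rV[R]_n -> 'rV[R]_d) u p : U p ->
    derivable A p u -> derivable C p u ->
  is_derive p u (fun q => G (F q) (A q) (C q))
    ('D_('D_u F p) (fun q => G q (A p) (C p)) (F p)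
     + G (F p) ('D_u A p) (C p) + G (F p) (A p) ('D_u C p)).
Proof.
move=> Up dA dC.
have chain y z : is_derive p u (fun q => G (F q) y z)
    ('D_('D_u F p) (fun q => G q y z) (F p)).
  exact: (is_derive_chain u (dF Up) (@G_differentiable _ y z (FU Up))).
rewrite -(is_derive_val (chain (A p) (C p))).
apply: (@is_derive_eval2 R _ _ d d (fun q y z => G (F q) y z) A C p u _ _ _ dA dC).
- by apply: filterS (nearU Up) => q Uq y; apply: G_linr; exact: FU.
- by apply: filterS (nearU Up) => q Uq y; apply: G_linl; exact: FU.
- by move=> y z; apply: is_derive_derivable; exact: chain.
Qed.

Lemma is_derive_dF_Dc u v w p : U p ->
  is_derive p u (fun q => 'D_(Dc q v w) F q)
    ('D_u ('D_(Dc p v w) F) p + 'D_('D_u (fun q => Dc q v w) p) F p).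
Proof.
move=> Up; apply: (is_derive_eval (T := fun q y => 'D_y F q)).
- by apply: filterS (nearU Up) => q Uq; apply: derive_dir_linear; exact: dF.
- by move=> y; apply: diff_derivable; exact: ddF.
- apply: diff_derivable; exact: Dc_differentiable.
Qed.

Definition cov_dF v w p := 'D_v ('D_w F) p + G (F p) ('D_v F p) ('D_w F p).

Lemma is_derive_cov_dF u v w p : U p ->
  is_derive p u (cov_dF v w)
   ('D_u ('D_v ('D_w F)) p +
    ('D_('D_u F p) (fun q => G q ('D_v F p) ('D_w F p)) (F p)
     + G (F p) ('D_u ('D_v F) p) ('D_w F p)
     + G (F p) ('D_v F p) ('D_u ('D_w F) p))).
Proof.
move=> Up; apply: is_deriveD.
  apply: derivableP; apply: diff_derivable; apply: smooth_differentiable Up.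
  by do 2!apply: smooth_derive.
by apply: is_derive_G_along => //; apply: diff_derivable; exact: ddF.
Qed.

Lemma is_derive_sff u v w p : U p ->
  is_derive p u (sff v w) ('D_u (cov_dF v w) p - 'D_u (fun q => 'D_(Dc q v w) F q) p).
Proof.
move=> Up; apply: is_deriveB; apply: derivableP; apply: is_derive_derivable.
  exact: is_derive_cov_dF.
exact: is_derive_dF_Dc.
Qed.

(** nabla~_u nabla~_v (dF w), by splitting nabla~_v (dF w) into its tangential
    and normal parts. *)
Lemma cov_sffE u v w p : U p ->
  'D_u (cov_dF v w) p + G (F p) ('D_u F p) (cov_dF v w p) =
  cov_sff u v w p + sff u (Dc p v w) p +
  ('D_(Dc p u (Dc p v w)) F p + 'D_('D_u (fun q => Dc q v w) p) F p).
Proof.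
move=> Up; rewrite /cov_sff.
rewrite (is_derive_val (is_derive_sff u v w Up)).
rewrite (is_derive_val (is_derive_dF_Dc u v w Up)).
have -> : cov_dF v w p = sff v w p + 'D_(Dc p v w) F p by rewrite subrK.
rewrite (linear_funD (G_linr ('D_u F p) (FU Up))) /=.
rewrite [sff u (Dc p v w) p]/sff.
set a1 := 'D_u (cov_dF v w) p; set a2 := G _ _ (sff _ _ _).
set a3 := G _ _ ('D_(Dc p v w) F p).
set a4 := 'D_u ('D_(Dc p v w) F) p; set a5 := 'D_('D_u _ p) F p.
set a6 := 'D_(Dc p u _) F p.
clearbody a1 a2 a3 a4 a5 a6.
by apply/rowP => j; rewrite !mxE; ring.
Qed.

(** The same second covariant derivative, expanded by the chain rule. *)
Lemma cov_dF_second u v w p : U p ->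
  'D_u (cov_dF v w) p + G (F p) ('D_u F p) (cov_dF v w p) =
  'D_u ('D_v ('D_w F)) p
  + ('D_('D_u F p) (fun q => G q ('D_v F p) ('D_w F p)) (F p)
     + G (F p) ('D_u ('D_v F) p) ('D_w F p) + G (F p) ('D_v F p) ('D_u ('D_w F) p))
  + (G (F p) ('D_u F p) ('D_v ('D_w F) p)
     + G (F p) ('D_u F p) (G (F p) ('D_v F p) ('D_w F p))).
Proof.
move=> Up; rewrite (is_derive_val (is_derive_cov_dF u v w Up)).
congr (_ + _); exact: (linear_funD (G_linr ('D_u F p) (FU Up))).
Qed.

(** The bookkeeping of [gauss_vector]: the terms c, e and e', in which one
    covariant derivative hits an argument of the other, cancel once the
    derivatives a and a' commute. *)
Lemma commute_difference (a a' b b' c c' e e' g g' K K' t t' l1 l1' l2 l2' : 'rV[R]_d) :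
    a = a' -> c = c' ->
    a + (b + c + e) + (e' + g) = K + t + (l1 + l2) ->
    a' + (b' + c' + e') + (e + g') = K' + t' + (l1' + l2') ->
  b + g - (b' + g') = K - K' + t - t' + (l2 + l1 - (l2' + l1')).
Proof.
move=> <- <- E1 E2.
transitivity (a + (b + c + e) + (e' + g) - (a + (b' + c + e') + (e + g'))).
  by clear E1 E2; apply/rowP => j; rewrite !mxE; ring.
by rewrite E1 E2; clear E1 E2; apply/rowP => j; rewrite !mxE; ring.
Qed.

(** Antisymmetrizing in u and v the two expressions of the second covariant
    derivative leaves the ambient curvature in one and the curvature of [Dc]
    in the other. *)
Lemma gauss_vector u v w p : U p ->
  curv G (F p) ('D_u F p) ('D_v F p) ('D_w F p) =
  cov_sff u v w p - cov_sff v u w p + sff u (Dc p v w) p - sff v (Dc p u w) p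
  + 'D_(curv Dc p u v w) F p.
Proof.
move=> Up; have VF := FU Up.
have E1 := etrans (esym (cov_dF_second u v w Up)) (cov_sffE u v w Up).
have E2 := etrans (esym (cov_dF_second v u w Up)) (cov_sffE v u w Up).
rewrite (curvE _ _ (@G_linl _ ('D_w F p) VF)) (curvE _ _ (@Dc_linl _ w Up)).
have dlin := derive_dir_linear (dF Up).
rewrite (linear_funB dlin) !(linear_funD dlin).
have S1 := derive_comm_smooth u v (smooth_derive hF w) Up.
have S2 := congr1 (fun y => G (F p) y ('D_w F p)) (derive_comm_smooth u v hF Up).
exact: (commute_difference S1 S2 E1 E2).
Qed.

(** [B_parallel] is the rule that the metric satisfies for a semi-symmetric
    connection [G]; with [phi] zero it says that [G] is metric. *)
Variables (B : 'rV[R]_d -> 'rV[R]_d -> 'rV[R]_d -> R) (phi : 'rV[R]_d -> 'rV[R]_d -> R).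
Hypotheses (B_lin : forall q u, V q -> scalar (B q u))
  (B_sym : forall q u v, V q -> B q u v = B q v u)
  (B_differentiable : forall q u v, V q -> differentiable (fun q => B q u v) q)
  (B_parallel : forall q u y z, V q ->
     'D_u (fun q => B q y z) q + phi q y * B q u z + phi q z * B q y u =
     B q (G q u y) z + B q y (G q u z))
  (sff_normal : forall u v w p, U p -> B (F p) (sff u v p) ('D_w F p) = 0).

(** Differentiating the identity B (sigma(v, w)) (dF z) = 0 along u moves the
    derivative from the normal field to dF z, whose covariant derivative has
    normal part sigma(u, z). *)
Lemma cov_sff_tangent u v w z p : U p ->
  B (F p) (cov_sff u v w p) ('D_z F p) =
  - B (F p) (sff v w p) (sff u z p)
  + phi (F p) (sff v w p) * B (F p) ('D_u F p) ('D_z F p).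
Proof.
have comb (b1 b2 b3 b4 b5 b6 : R) :
    0 = b3 + b1 + b2 -> b3 + b4 = b5 + b6 -> b1 + b5 = - b2 - b6 + b4.
  by move=> E1 E2; lra.
move=> Up; have VF := FU Up.
have Blinl q y : V q -> scalar (B q ^~ y).
  by move=> Vq c y1 y2; rewrite !(B_sym _ y) // B_lin.
have chain y1 y2 : is_derive p u (fun q => B (F q) y1 y2)
    ('D_('D_u F p) (fun q => B q y1 y2) (F p)).
  exact: (is_derive_chain u (dF Up) (@B_differentiable _ y1 y2 VF)).
have D0 : is_derive p u (fun q => B (F q) (sff v w q) ('D_z F q)) 0.
  have d0 : is_derive p u (cst 0 : 'rV[R]_n -> R) 0 by exact: is_derive_cst.
  apply: near_eq_is_derive d0.
  by apply: filterS (nearU Up) => q Uq; rewrite sff_normal.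
have D1 : is_derive p u (fun q => B (F q) (sff v w q) ('D_z F q))
   ('D_u (fun q => B (F q) (sff v w p) ('D_z F p)) p
    + B (F p) ('D_u (sff v w) p) ('D_z F p) + B (F p) (sff v w p) ('D_u ('D_z F) p)).
  apply: (@is_derive_eval2 R _ _ d d (fun q y z => B (F q) y z) (sff v w) ('D_z F) p u).
  - by apply: filterS (nearU Up) => q Uq y; apply: B_lin; exact: FU.
  - by apply: filterS (nearU Up) => q Uq y; apply: Blinl; exact: FU.
  - by move=> y1 y2; apply: is_derive_derivable; exact: chain.
  - by apply: is_derive_derivable; exact: is_derive_sff.
  - by apply: diff_derivable; exact: ddF.
have E := etrans (esym (is_derive_val D0)) (is_derive_val D1).
rewrite (is_derive_val (chain (sff v w p) ('D_z F p))) in E.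
have N1 := sff_normal v w u Up.
have par := @B_parallel (F p) ('D_u F p) (sff v w p) ('D_z F p) VF.
have N2 : B (F p) (sff v w p) (sff u z p) =
   B (F p) (sff v w p) ('D_u ('D_z F) p) + B (F p) (sff v w p) (G (F p) ('D_u F p) ('D_z F p)).
  rewrite {2}/sff (linear_funB (@B_lin _ _ VF)) (linear_funD (@B_lin _ _ VF)).
  by rewrite (sff_normal v w (Dc p u z) Up) subr0.
have cov : B (F p) (cov_sff u v w p) ('D_z F p) = B (F p) ('D_u (sff v w) p) ('D_z F p)
   + B (F p) (G (F p) ('D_u F p) (sff v w p)) ('D_z F p).
  exact: (linear_funD (Blinl _ _ VF)).
rewrite N1 mulr0 addr0 in par.
rewrite cov N2 opprD.
exact: comb E par.
Qed.

Lemma gauss_equation u v w z p : U p ->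
  B (F p) ('D_(curv Dc p u v w) F p) ('D_z F p) =
  B (F p) (curv G (F p) ('D_u F p) ('D_v F p) ('D_w F p)) ('D_z F p)
  + B (F p) (sff v w p) (sff u z p) - B (F p) (sff u w p) (sff v z p)
  - phi (F p) (sff v w p) * B (F p) ('D_u F p) ('D_z F p)
  + phi (F p) (sff u w p) * B (F p) ('D_v F p) ('D_z F p).
Proof.
move=> Up; have VF := FU Up.
have Blinl y : linear (B (F p) ^~ y : _ -> R^o).
  by move=> c y1 y2; rewrite !(B_sym _ y) // B_lin.
have lD := linear_funD (Blinl ('D_z F p)); have lB := linear_funB (Blinl ('D_z F p)).
have Bsum y1 y2 y3 y4 y5 : B (F p) (y1 - y2 + y3 - y4 + y5) ('D_z F p) =
    B (F p) y1 ('D_z F p) - B (F p) y2 ('D_z F p) + B (F p) y3 ('D_z F p)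
    - B (F p) y4 ('D_z F p) + B (F p) y5 ('D_z F p).
  by rewrite lD lB lD lB.
have E := etrans (congr1 (B (F p) ^~ ('D_z F p)) (gauss_vector u v w Up))
  (Bsum _ _ _ _ _).
have comb (x c1 c2 n1 n2 t a a' b b' : R) : x = c1 - c2 + n1 - n2 + t ->
    c1 = - a + b -> c2 = - a' + b' -> n1 = 0 -> n2 = 0 ->
    t = x + a - a' - b + b'.
  by move=> -> -> -> -> ->; ring.
exact: comb E (cov_sff_tangent u v w z Up) (cov_sff_tangent v u w z Up)
  (sff_normal u (Dc p v w) z Up) (sff_normal v (Dc p u w) z Up).
Qed.

End GaussEquation.

(** * Semi-symmetric connections *)

Section SemiSymmetric.
Context {R : realType} {d : nat} {N : manifold R d}.
Variables (g : form2 N) (LC : christoffel N) (phi : form1 N).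
Hypotheses (hg : is_metric g) (hLC : is_levi_civita g LC) (hphi : is_form1 phi).
Variable a : mchart N.
Local Notation G := (semi_symmetric LC phi a).

Let phi_lin q : mrange a q -> scalar (phi a q).
Proof. by case: hphi => h _ _; exact: h. Qed.

Let phi_smooth u : smooth_on (mrange a) (fun q => phi a q u).
Proof. by case: hphi. Qed.

Let LC_linr q u : mrange a q -> linear (LC a q u).
Proof. by case: hLC => -[h _ _ _] _ _; exact: h. Qed.

Let LC_linl q v : mrange a q -> linear (LC a q ^~ v).
Proof. by case: hLC => -[_ h _ _] _ _; exact: h. Qed.

Let LC_smooth u v : smooth_on (mrange a) (fun q => LC a q u v).
Proof. by case: hLC => -[_ _ h _] _ _; exact: h. Qed.

Lemma levi_civita_sym q u v : mrange a q -> LC a q u v = LC a q v u.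
Proof.
case: hLC => _ tf _ aq.
have := tf a (cst u) (cst v) q (smooth_cst _ _) (smooth_cst _ _) aq.
rewrite /nabla /bracket !derive_cst !add0r oppr0 => /eqP.
by rewrite subr_eq0 => /eqP.
Qed.

Lemma levi_civita_metric q u y z : mrange a q ->
  'D_u (fun q => g a q y z) q = g a q (LC a q u y) z + g a q y (LC a q u z).
Proof.
case: hLC => _ _ mc aq.
have := mc a (cst u) (cst y) (cst z) q (smooth_cst _ _) (smooth_cst _ _)
  (smooth_cst _ _) aq.
by rewrite /nabla !derive_cst !add0r.
Qed.

Lemma semi_symmetric_linr q u : mrange a q -> linear (G q u).
Proof.
move=> aq c y z; rewrite /semi_symmetric LC_linr // phi_lin // scalerDl -scalerA.
by rewrite scalerDr addrACA.
Qed.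

Lemma semi_symmetric_linl q v : mrange a q -> linear (G q ^~ v).
Proof.
move=> aq c y z; rewrite /semi_symmetric LC_linl // !scalerDr.
by rewrite [phi a q v *: (c *: y)]scalerA mulrC -scalerA addrACA.
Qed.

Lemma semi_symmetric_differentiable q u v :
  mrange a q -> differentiable (fun q => G q u v) q.
Proof.
move=> aq; apply: differentiableD.
  exact: (smooth_differentiable (LC_smooth u v)).
apply: differentiableZl; exact: (smooth_differentiable (phi_smooth v)).
Qed.

Lemma metric_linr q u : mrange a q -> scalar (g a q u).
Proof. by case: hg => h _ _ _ _; exact: h. Qed.

Lemma metric_sym q u v : mrange a q -> g a q u v = g a q v u.
Proof. by case: hg => _ h _ _ _; exact: h. Qed.

Lemma metric_linl q v : mrange a q -> linear (g a q ^~ v : _ -> R^o).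
Proof. by move=> aq c y z; rewrite !(metric_sym _ v aq) metric_linr. Qed.

Lemma metric_differentiable q u v :
  mrange a q -> differentiable (fun q => g a q u v) q.
Proof. by case: hg => _ _ _ h _; exact: (smooth_differentiable (h a u v)). Qed.

(** The covariant derivative of g for the semi-symmetric connection, whose
    two phi terms come from phi(y) u and phi(z) u. *)
Lemma semi_symmetric_metric q u y z : mrange a q ->
  'D_u (fun q => g a q y z) q + phi a q y * g a q u z + phi a q z * g a q y u =
  g a q (G q u y) z + g a q y (G q u z).
Proof.
move=> aq; rewrite levi_civita_metric // /semi_symmetric.
rewrite (linear_funD (metric_linl z aq)) (linear_funZ (metric_linl z aq)).
rewrite (linear_funD (metric_linr y aq)) (linear_funZ (metric_linr y aq)).
rewrite /GRing.scale /=; ring.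
Qed.

Lemma s_tensorE q u w : s_tensor LC phi a q u w =
  'D_u (fun q => phi a q w) q - phi a q (LC a q u w) - phi a q u * phi a q w.
Proof. by rewrite /s_tensor /nabla derive_cst add0r. Qed.

(** Torsion-freeness enters once: it cancels the two terms phi(w) nabla_u v
    and phi(w) nabla_v u. *)
Lemma curv_semi_symmetric q u v w : mrange a q ->
  curv G q u v w = curv (LC a) q u v w
    + s_tensor LC phi a q u w *: v - s_tensor LC phi a q v w *: u.
Proof.
move=> aq.
rewrite (curvE _ _ (semi_symmetric_linl _ aq)) (curvE _ _ (@LC_linl _ w aq)).
have dG x y : 'D_x (fun q => G q y w) q =
    'D_x (fun q => LC a q y w) q + 'D_x (fun q => phi a q w) q *: y.
  have dLC := smooth_differentiable (LC_smooth y w) aq.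
  have dphi := smooth_differentiable (phi_smooth w) aq.
  have dp : is_derive q x (fun q => phi a q w *: y)
      (phi a q w *: 'D_x (cst y) q + 'D_x (fun q => phi a q w) q *: y).
    by apply: is_derive_scale; [exact: diff_derivable | exact: derivable_cst].
  rewrite /semi_symmetric (deriveD (diff_derivable (v := x) dLC) (is_derive_derivable dp)).
  by rewrite (is_derive_val dp) derive_cst scaler0 add0r.
rewrite !dG !s_tensorE /semi_symmetric.
rewrite !(linear_funD (LC_linr _ aq)) !(linear_funZ (LC_linr _ aq)).
rewrite !(linear_funD (phi_lin aq)) !(linear_funZ (phi_lin aq)).
rewrite (levi_civita_sym v u aq) /GRing.scale /=.
set dv := 'D_u (fun q => LC a q v w) q; set du := 'D_v (fun q => LC a q u w) q.
set pu := 'D_u _ q; set pv := 'D_v _ q.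
move: dv du pu pv (LC a q u (LC a q v w)) (LC a q v (LC a q u w)) (LC a q u v)
  (phi a q (LC a q v w)) (phi a q (LC a q u w)).
move=> dv du pu pv x1 x2 x3 y1 y2; apply/rowP => j; rewrite !mxE; ring.
Qed.

End SemiSymmetric.

(** * Submanifolds in charts *)

Section LocalRepresentative.
Context {R : realType} {n d : nat} {M : manifold R n} {N : manifold R d}.
Variables (f : M -> N) (i : mchart M) (a : mchart N).
Local Notation F := (lrep f i a).
Local Notation U := (lrep_dom f i a).

Lemma lrep_dom_mrange p : U p -> mrange i p.
Proof. by case=> y [iy _] <-; exists y. Qed.

Lemma lrep_mrange p : U p -> mrange a (F p).
Proof.
case=> y [iy ay] <-; exists (f y) => //.
by rewrite /lrep /= (m_coordK iy).
Qed.

Lemma lrep_dom_open : continuous f -> open U.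
Proof.
move=> cf; rewrite openE => p [y [iy ay] <-].
have ip : mrange i (mcoord i y) by exists y.
have nr : nbhs (mcoord i y) (mrange i).
  by apply: open_nbhs_nbhs; split=> //; exact: m_range_open.
have nf : nbhs (mcoord i y) ((f \o mparam i) @^-1` mdom a).
  have cp := m_param_cont ip.
  have cfp : {for mcoord i y, continuous (f \o mparam i)}.
    by apply: (continuous_comp cp); exact: cf.
  apply: cfp; apply: open_nbhs_nbhs; split; first exact: m_dom_open.
  by rewrite /= (m_coordK iy).
have sub : mrange i `&` ((f \o mparam i) @^-1` mdom a) `<=` U.
  move=> _ [[z iz <-]] /=; rewrite (m_coordK iz) => az.
  by exists z.
by rewrite /interior; apply: filterS sub _; exact: filterI.
Qed.

End LocalRepresentative.

Section Submanifold.
Context {R : realType} {n d : nat} {M : manifold R n} {N : manifold R d}.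
Variables (g : form2 N) (LC : christoffel N) (phi : form1 N)
  (f : M -> N) (gM : form2 M) (D : christoffel M).
Hypotheses (hg : is_metric g) (hLC : is_levi_civita g LC) (hphi : is_form1 phi)
  (hf : is_immersion f) (hiso : is_isometric f gM g)
  (hD : is_induced_connection f g (semi_symmetric LC phi) D).
Variables (i : mchart M) (a : mchart N).
Local Notation G := (semi_symmetric LC phi).
Local Notation F := (lrep f i a).
Local Notation U := (lrep_dom f i a).
Local Notation sigma := (second_ff f G D i a).

Let oU : open U. Proof. by apply: lrep_dom_open; case: hf. Qed.

Let hF : smooth_on U F. Proof. by case: hf => _ h _; exact: h. Qed.

Let FU p : U p -> mrange a (F p). Proof. exact: lrep_mrange. Qed.



Let D_linl q u : U q -> linear (D i q ^~ u).
Proof. by move/lrep_dom_mrange; case: hD => -[_ h _ _] _; exact: h. Qed.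

Let D_differentiable q u v : U q -> differentiable (fun q => D i q u v) q.
Proof.
move/lrep_dom_mrange; case: hD => -[_ _ h _] _.
exact: (smooth_differentiable (h i u v)).
Qed.

Lemma second_ffE p u v : sigma p u v = sff F (G a) (D i) u v p.
Proof.
by rewrite /second_ff /second_ff_field /nabla_along /nabla derive_cst add0r.
Qed.

Lemma second_ff_normal p u v w : U p -> g a (F p) (sigma p u v) ('D_w F p) = 0.
Proof.
by case: hD => _ h Up; exact: (h i a (cst u) (cst v) p w (smooth_cst _ _) (smooth_cst _ _) Up).
Qed.

Let sff_normal u v w p : U p -> g a (F p) (sff F (G a) (D i) u v p) ('D_w F p) = 0.
Proof. by move=> Up; rewrite -second_ffE second_ff_normal. Qed.

Let dF_linear p : U p -> linear (fun u => 'D_u F p).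
Proof. by move=> Up; apply: derive_dir_linear; exact: (smooth_differentiable hF). Qed.

(** The semi-symmetric connection has torsion phi(v) u - phi(u) v, which is
    tangent to the submanifold; so the antisymmetric part of sigma is both
    tangent and normal. *)
Lemma second_ff_sym p u v : U p -> sigma p u v = sigma p v u.
Proof.
move=> Up; have aq := FU Up; have dlin := dF_linear Up.
pose y := phi a (F p) ('D_v F p) *: u - phi a (F p) ('D_u F p) *: v
  - (D i p u v - D i p v u).
have comb (x c1 c2 k l1 l2 : 'rV[R]_d) :
   (x + (k + c1) - l1) - (x + (k + c2) - l2) = c1 - c2 - (l1 - l2).
  by apply/rowP => j; rewrite !mxE; ring.
have diffE : sigma p u v - sigma p v u = 'D_y F p.
  rewrite /y (linear_funB dlin) (linear_funB dlin) (linear_funB dlin).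
  rewrite !(linear_funZ dlin) !second_ffE /sff /semi_symmetric.
  rewrite (levi_civita_sym hLC ('D_v F p) ('D_u F p) aq).
  rewrite (derive_comm_smooth oU v u hF Up).
  exact: comb.
have y0 : g a (F p) ('D_y F p) ('D_y F p) = 0.
  apply: etrans (congr1 (g a (F p) ^~ ('D_y F p)) (esym diffE)) _.
  apply: etrans (linear_funB (metric_linl hg _ aq) _ _) _.
  have N1 := second_ff_normal u v y Up; have N2 := second_ff_normal v u y Up.
  by apply: etrans (congr2 (fun s t : R => s - t) N1 N2) (subr0 _).
apply/eqP; rewrite -subr_eq0 diffE; apply/negPn/negP => yn0.
by case: hg => _ _ pos _ _; have := pos a _ _ aq yn0; rewrite y0 ltxx.
Qed.

Lemma gauss_submanifold p u v w z : U p ->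
  gM i p (curv (D i) p u v w) z =
  g a (F p) (curv (G a) (F p) ('D_u F p) ('D_v F p) ('D_w F p)) ('D_z F p)
  + g a (F p) (sigma p v w) (sigma p u z) - g a (F p) (sigma p u w) (sigma p v z)
  - phi a (F p) (sigma p v w) * gM i p u z + phi a (F p) (sigma p u w) * gM i p v z.
Proof.
move=> Up; rewrite !(hiso _ _ Up) !second_ffE.
have Gr := @semi_symmetric_linr R d N g LC phi hLC hphi a.
have Gl := @semi_symmetric_linl R d N g LC phi hLC a.
have Gd := @semi_symmetric_differentiable R d N g LC phi hLC hphi a.
have gr := @metric_linr R d N g hg a.
have gs := @metric_sym R d N g hg a.
have gd := @metric_differentiable R d N g hg a.
have gp := @semi_symmetric_metric R d N g LC phi hg hLC a.
exact: (gauss_equation oU hF FU Gr Gl Gd D_linl D_differentiable gr gs gd gp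
  sff_normal u v w z Up).
Qed.

End Submanifold.

(** * Orthonormal frames *)

Section Orthonormal.
Context {R : fieldType} {d : nat} {b : 'rV[R]_d -> 'rV[R]_d -> R}.
Hypothesis b_linl : forall y, linear (b ^~ y : 'rV[R]_d -> R^o).
Context {I : finType} {E : I -> 'rV[R]_d}.
Hypothesis orthoE : forall i j, b (E i) (E j) = (i == j)%:R.

Let M : 'M[R]_(#|I|, d) := \matrix_k E (enum_val k).

Let mulE (x : 'rV_#|I|) : x *m M = \sum_k x 0 k *: E (enum_val k).
Proof. by rewrite mulmx_sum_row; apply: eq_bigr => k _; rewrite rowK. Qed.

Let coord_mulE (x : 'rV_#|I|) k : b (x *m M) (E (enum_val k)) = x 0 k.
Proof.
rewrite mulE (linear_fun_sum (b_linl _)) (bigD1 k) //= big1 => [|l lk].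
  by rewrite addr0 (linear_funZ (b_linl _)) orthoE eqxx; exact: mulr1.
rewrite (linear_funZ (b_linl _)) orthoE (inj_eq enum_val_inj) (negPf lk).
exact: mulr0.
Qed.

Let M_free : row_free M.
Proof.
apply: inj_row_free => x x0; apply/rowP => k.
by rewrite -coord_mulE x0 (linear_fun0 (b_linl _)) mxE.
Qed.

(** Pairing a vanishing combination of the E i with each of them shows that
    they are linearly independent. *)
Lemma orthonormal_card : (#|I| <= d)%N.
Proof. by move/eqP: M_free => <-; exact: rank_leq_col. Qed.

Lemma orthonormal_expansion : #|I| = d -> forall y, y = \sum_i b y (E i) *: E i.
Proof.
move=> cardI y; have /submxP[x ->] : (y <= M)%MS.
  by apply: submx_full; rewrite /row_full (eqP M_free) cardI.
rewrite {1}mulE (reindex_onto (fun k : 'I_#|I| => enum_val k) enum_rank) /=.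
  by apply: eq_big => [k|k _]; rewrite ?enum_valK ?eqxx ?coord_mulE.
by move=> i _; rewrite enum_rankK.
Qed.

End Orthonormal.


(** * Symmetric matrices and the Cauchy-Schwarz inequality *)

Section CauchySchwarz.
Context {R : realType} {I : finType}.
Implicit Types x y : I -> R.

Lemma sum_sqr_sub x y (rho : R) :
  \sum_i (y i - rho * x i) ^+ 2 =
  \sum_i y i ^+ 2 - 2 * rho * (\sum_i x i * y i) + rho ^+ 2 * \sum_i x i ^+ 2.
Proof.
rewrite !mulr_sumr -sumrB -big_split /=; apply: eq_bigr => i _; ring.
Qed.

Lemma sum_sqr_ge0 x : 0 <= \sum_i x i ^+ 2.
Proof. by apply: sumr_ge0 => i _; exact: sqr_ge0. Qed.

Lemma sum_sqr_eq0 x : \sum_i x i ^+ 2 = 0 -> forall i, x i = 0.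
Proof.
move=> /eqP; rewrite psumr_eq0 => [|i _]; last exact: sqr_ge0.
by move=> /allP h i; apply/eqP; rewrite -sqrf_eq0; apply: h; rewrite mem_index_enum.
Qed.

(** Expand the nonnegative sum of squares of y - (Z / X) x, with X and Z the
    sums of the x_i ^ 2 and of the x_i y_i: this choice of the coefficient
    minimizes the sum. *)
Lemma cauchy_schwarz_sqrt x y :
  \sum_i x i * y i <= Num.sqrt (\sum_i x i ^+ 2) * Num.sqrt (\sum_i y i ^+ 2).
Proof.
set X := \sum_i x i ^+ 2; set Y := \sum_i y i ^+ 2; set Z := \sum_i x i * y i.
have X0 : 0 <= X by exact: sum_sqr_ge0.
have Y0 : 0 <= Y by exact: sum_sqr_ge0.
have [XE|Xn0] := eqVneq X 0.
  rewrite XE sqrtr0 mul0r /Z big1 // => i _.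
  by rewrite (sum_sqr_eq0 XE) mul0r.
have Xp : 0 < X by rewrite lt_def Xn0.
have := sum_sqr_ge0 (fun i => y i - Z / X * x i).
rewrite sum_sqr_sub -/X -/Y -/Z => h.
have {}h : Z ^+ 2 <= X * Y.
  have -> : X * Y = Z ^+ 2 + X * (Y - 2 * (Z / X) * Z + (Z / X) ^+ 2 * X).
    by field.
  by rewrite lerDl mulr_ge0.
rewrite -sqrtrM // (le_trans (ler_norm _)) // -sqrtr_sqr.
by rewrite ler_wsqrtr.
Qed.

Lemma cauchy_schwarz_sqrt_eq x y :
    (forall i, 0 <= x i) -> (forall i, 0 <= y i) -> \sum_i x i ^+ 2 != 0 ->
  \sum_i x i * y i = Num.sqrt (\sum_i x i ^+ 2) * Num.sqrt (\sum_i y i ^+ 2) <->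
  exists rho, 0 <= rho /\ forall i, y i = rho * x i.
Proof.
set X := \sum_i x i ^+ 2; set Y := \sum_i y i ^+ 2; set Z := \sum_i x i * y i.
move=> x0 y0 Xn0; have X0 : 0 <= X by exact: sum_sqr_ge0.
have Y0 : 0 <= Y by exact: sum_sqr_ge0.
split=> [ZE|[rho [rho0 yE]]].
  exists (Z / X); split.
    by rewrite divr_ge0 //; apply: sumr_ge0 => i _; rewrite mulr_ge0.
  move=> i; apply/eqP; rewrite -subr_eq0; apply/eqP; move: i.
  apply: sum_sqr_eq0; rewrite sum_sqr_sub -/X -/Y -/Z.
  have ZZ : Z ^+ 2 = X * Y by rewrite ZE exprMn !sqr_sqrtr.
  have -> : Y - 2 * (Z / X) * Z + (Z / X) ^+ 2 * X = Y - Z ^+ 2 / X by field.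
  by rewrite ZZ mulrAC divff // mul1r subrr.
have -> : Y = rho ^+ 2 * X.
  by rewrite /Y mulr_sumr; apply: eq_bigr => i _; rewrite yE exprMn.
have -> : Z = rho * X.
  by rewrite /Z mulr_sumr; apply: eq_bigr => i _; rewrite yE mulrCA.
rewrite sqrtrM ?sqr_ge0// sqrtr_sqr ger0_norm//.
by rewrite mulrCA -expr2 sqr_sqrtr.
Qed.

End CauchySchwarz.

Section MatrixInequality.
Context {R : realType} {n : nat} (hn : (2 <= n)%N).
Implicit Types A : 'M[R]_n.
Local Notation N := (n%:R : R).
Local Notation i0 := (first hn).

(** For A the matrix of sigma^alpha, the contribution of alpha to the Ricci
    curvature in the direction of the first frame vector. *)
Definition ricci_mx A : R :=
  \sum_(j | j != i0) (A i0 i0 * A j j - A i0 j ^+ 2).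

(** [rest_trace], [off_sqr] and [rest_defect] decompose a symmetric matrix
    along its first index: [rest_defect] is the squared distance of the
    complementary block to the scalar matrices. *)
Definition rest_trace A : R := \sum_(j | j != i0) A j j.

Definition off_sqr A : R := \sum_(j | j != i0) A i0 j ^+ 2.

Definition rest_defect A : R := \sum_(j | j != i0) \sum_(k | k != i0)
  (A j k - (j == k)%:R * (rest_trace A / (N - 1))) ^+ 2.

Lemma N_ge2 : 2 <= N. Proof. by rewrite ler_nat. Qed.

Lemma trace_split A : N * Halpha A = A i0 i0 + rest_trace A.
Proof.
have N0 : N != 0 by have := N_ge2; lra.
by rewrite /Halpha mulrA divff // mul1r (bigD1 i0).
Qed.

Lemma sum_rest_const (x : R) : \sum_(j < n | j != i0) x = (N - 1) * x.
Proof.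
have -> : (N - 1) * x = \sum_(j < n) x - x.
  by rewrite sumr_const card_ord -mulr_natl; ring.
by rewrite [X in _ = X - _](bigD1 i0) //= addrAC subrr add0r.
Qed.

Lemma sqnorm_mxE A (sym : forall j k, A j k = A k j) :
  sqnorm_mx A = A i0 i0 ^+ 2 + 2 * off_sqr A +
                rest_trace A ^+ 2 / (N - 1) + rest_defect A.
Proof.
have N1 : N - 1 != 0 by have := N_ge2; lra.
set t := rest_trace A / (N - 1).
have -> : rest_defect A = \sum_(j | j != i0) \sum_(k | k != i0) A j k ^+ 2
           - rest_trace A ^+ 2 / (N - 1).
  transitivity (\sum_(j | j != i0)
     (\sum_(k | k != i0) A j k ^+ 2 - 2 * t * A j j + t ^+ 2)).
    rewrite /rest_defect -/t; apply: eq_bigr => j j0.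
    rewrite (bigD1 j) //= [X in _ = X - _ + _](bigD1 j) //= eqxx mul1r.
    rewrite (eq_bigr (fun k => A j k ^+ 2)); first by ring.
    by move=> k /andP[_ /negPf]; rewrite eq_sym => ->; rewrite mul0r subr0.
  rewrite !big_split /= sum_rest_const sumrN -mulr_sumr -/(rest_trace A) /t.
  by field.
rewrite /sqnorm_mx (bigD1 i0) //= (bigD1 i0) //= -/(off_sqr A).
rewrite (eq_bigr (fun j => A i0 j ^+ 2 + \sum_(k | k != i0) A j k ^+ 2)).
  by rewrite big_split /= -/(off_sqr A); ring.
by move=> j j0; rewrite (bigD1 i0) //= (sym j i0).
Qed.

Lemma off_sqr_ge0 A : 0 <= off_sqr A.
Proof. by apply: sumr_ge0 => j _; exact: sqr_ge0. Qed.

Lemma rest_defect_ge0 A : 0 <= rest_defect A.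
Proof. by do 2!(apply: sumr_ge0 => ? _); exact: sqr_ge0. Qed.

Lemma Dalpha_ge0 A : 0 <= Dalpha A. Proof. exact: sqrtr_ge0. Qed.

Lemma root_alphaE A : root_alpha A = Dalpha A.
Proof. by rewrite /root_alpha /Dalpha; congr (Num.sqrt (_ / _)); ring. Qed.

(** The radicand of [Dalpha] is nonnegative: by the decomposition of the
    squared norm it is a square plus multiples of [off_sqr] and
    [rest_defect]. *)
Lemma Dalpha_sqr A (sym : forall j k, A j k = A k j) :
  Dalpha A ^+ 2 = N * (sqnorm_mx A - N * Halpha A ^+ 2) / (N - 1) /\
  Dalpha A ^+ 2 = (N / (N - 1) * (A i0 i0 - Halpha A)) ^+ 2
     + N / (N - 1) * (2 * off_sqr A + rest_defect A).
Proof.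
have N1 : N - 1 != 0 by have := N_ge2; lra.
set y := (X in _ /\ _ = X).
have xy : N * (sqnorm_mx A - N * Halpha A ^+ 2) / (N - 1) = y.
  rewrite sqnorm_mxE // /y.
  have -> : rest_trace A = N * Halpha A - A i0 i0 by rewrite trace_split; ring.
  by field.
have y0 : 0 <= y.
  rewrite addr_ge0 ?sqr_ge0 // mulr_ge0 //.
    by rewrite divr_ge0 //; have := N_ge2; lra.
  by have := off_sqr_ge0 A; have := rest_defect_ge0 A; lra.
by rewrite /Dalpha xy sqr_sqrtr.
Qed.

(** Each of the three summands on the right is nonnegative, the first one by
    [deviation_mul_ge]. *)
Lemma ricci_mx_excess A (sym : forall j k, A j k = A k j) :
  ricci_mx A - calH (n := n) `|Halpha A| (sqnorm_mx A) =
  (N - 2) * ((A i0 i0 - Halpha A) * Halpha A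
             + (N - 1) / N * (`|Halpha A| * Dalpha A))
  + (N - 2) / N * off_sqr A + (N - 1) / N * rest_defect A.
Proof.
have N1 : N - 1 != 0 by have := N_ge2; lra.
have N0 : N != 0 by have := N_ge2; lra.
rewrite /calH real_normK ?num_real // -/(Dalpha A) /ricci_mx.
rewrite sumrB -mulr_sumr -/(rest_trace A) -/(off_sqr A) sqnorm_mxE //.
have -> : rest_trace A = N * Halpha A - A i0 i0 by rewrite trace_split; ring.
by field; rewrite N0 N1.
Qed.

(** The second formula of [Dalpha_sqr] without its nonnegative terms. *)
Lemma deviation_le A (sym : forall j k, A j k = A k j) :
  `|A i0 i0 - Halpha A| <= (N - 1) / N * Dalpha A.
Proof.
have N2 := N_ge2.
have N1 : N - 1 != 0 by lra.
have N0 : N != 0 by lra.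
have c0 : 0 <= (N - 1) / N by rewrite divr_ge0; lra.
have D0 := Dalpha_ge0 A.
have cD0 : 0 <= (N - 1) / N * Dalpha A by rewrite mulr_ge0.
rewrite -(ler_pXn2r (ltn0Sn 1)) // ?nnegrE // real_normK ?num_real // exprMn.
rewrite (Dalpha_sqr sym).2.
have -> : ((N - 1) / N) ^+ 2 * ((N / (N - 1) * (A i0 i0 - Halpha A)) ^+ 2 +
   N / (N - 1) * (2 * off_sqr A + rest_defect A)) =
   (A i0 i0 - Halpha A) ^+ 2 + (N - 1) / N * (2 * off_sqr A + rest_defect A).
  by field; rewrite N0 N1.
rewrite lerDl mulr_ge0 //.
by have := off_sqr_ge0 A; have := rest_defect_ge0 A; lra.
Qed.

Lemma deviation_mul_ge A (sym : forall j k, A j k = A k j) :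
  0 <= (A i0 i0 - Halpha A) * Halpha A
       + (N - 1) / N * (`|Halpha A| * Dalpha A).
Proof.
set b := A i0 i0 - _.
have := ler_norm (- (b * Halpha A)); rewrite normrN normrM.
have := ler_wpM2r (normr_ge0 (Halpha A)) (deviation_le sym).
rewrite -/b => h1 h2; have := le_trans h2 h1.
by rewrite [`|Halpha A| * _]mulrC mulrA; lra.
Qed.

Lemma ricci_mx_ge A (sym : forall j k, A j k = A k j) :
  calH (n := n) `|Halpha A| (sqnorm_mx A) <= ricci_mx A.
Proof.
have N2 := N_ge2.
rewrite -subr_ge0 ricci_mx_excess // !addr_ge0 // mulr_ge0 ?divr_ge0
  ?deviation_mul_ge ?off_sqr_ge0 ?rest_defect_ge0 //; lra.
Qed.

Definition special_mx A : Prop := exists eps : R,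
  admissible_sign (Halpha A) eps /\
  A = \matrix_(k, l) (if k == l then
        if k == i0 then lambda_alpha eps A else mu_alpha eps A else 0).

Lemma admissible_signP (h eps : R) : admissible_sign h eps ->
  eps * h = `|h| /\ eps ^+ 2 = 1.
Proof.
rewrite /admissible_sign; have [->|h0] := eqVneq h 0.
  by rewrite mulr0 normr0; case=> ->; rewrite ?sqrrN expr1n.
by move=> ->; rewrite sqr_sg h0 mulrC -[X in X * _](mulr_sg_norm h) mulrAC
  -expr2 sqr_sg h0 mul1r.
Qed.

(** For n >= 3 the three coefficients in [ricci_mx_excess] are positive, so
    equality kills the first row outside the diagonal and [rest_defect]; then
    the deviation A_11 - h is, up to sign, (n - 1) / n times [Dalpha A], and
    the first summand forces its sign to be opposite to that of h. *)
Lemma ricci_mx_eq A (sym : forall j k, A j k = A k j) (hn3 : (3 <= n)%N) :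
  ricci_mx A = calH (n := n) `|Halpha A| (sqnorm_mx A) <-> special_mx A.
Proof.
have N3 : 3 <= N by rewrite ler_nat.
have N1 : N - 1 != 0 by lra.
have N0 : N != 0 by lra.
set H := Halpha A; set D := Dalpha A.
split=> [/eqP|[eps [/admissible_signP[epsH eps2] AE]]]; last first.
  have AEx k l : A k l = (if k == l then
      if k == i0 then lambda_alpha eps A else mu_alpha eps A else 0).
    by rewrite {1}AE mxE.
  have Aii : A i0 i0 = lambda_alpha eps A by rewrite AEx !eqxx.
  have Ajj j : j != i0 -> A j j = mu_alpha eps A.
    by move=> /negPf j0; rewrite AEx eqxx j0.
  have A0j j : j != i0 -> A i0 j = 0.
    by rewrite eq_sym => /negPf j0; rewrite AEx j0.
  rewrite /ricci_mx (eq_bigr (fun=> lambda_alpha eps A * mu_alpha eps A)); last first.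
    by move=> j j0; rewrite Aii Ajj // A0j // expr0n subr0.
  rewrite sum_rest_const /calH real_normK ?num_real // -/(Dalpha A).
  have SE : sqnorm_mx A = N * H ^+ 2 + (N - 1) / N * D ^+ 2.
    by rewrite (Dalpha_sqr sym).1 -/H; field; rewrite N0 N1.
  rewrite SE /lambda_alpha /mu_alpha root_alphaE -/H -/D -epsH.
  transitivity ((N - 1) * (H ^+ 2 - (N - 2) / N * (eps * H) * D
     - eps ^+ 2 * ((N - 1) / N ^+ 2) * D ^+ 2)); first by field.
  by rewrite eps2 -/H; field.
rewrite -subr_eq0 ricci_mx_excess //.
have c1 := deviation_mul_ge sym; have c2 := off_sqr_ge0 A.
have c3 := rest_defect_ge0 A; rewrite -/H -/D.
have p1 : 0 < N - 2 by lra.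
have p2 : 0 < (N - 2) / N by rewrite divr_gt0 //; lra.
have p3 : 0 < (N - 1) / N by rewrite divr_gt0 //; lra.
have q1 := mulr_ge0 (ltW p1) c1; have q2 := mulr_ge0 (ltW p2) c2.
have q3 := mulr_ge0 (ltW p3) c3.
rewrite (paddr_eq0 (addr_ge0 q1 q2) q3) (paddr_eq0 q1 q2).
have pmul_eq0 (k y : R) : 0 < k -> (k * y == 0) = (y == 0).
  by move=> k0; rewrite mulf_eq0 gt_eqF.
rewrite (pmul_eq0 _ _ p1) (pmul_eq0 _ _ p2) (pmul_eq0 _ _ p3).
move=> /andP[/andP[/eqP e1 /eqP e2] /eqP e3].
set b := A i0 i0 - H in e1.
have bE : `|b| = (N - 1) / N * D.
  have h : D = N / (N - 1) * `|b|.
    have h0 : 0 <= N / (N - 1) * `|b| by rewrite mulr_ge0 ?divr_ge0 //; lra.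
    apply/eqP; rewrite -(eqrXn2 (ltn0Sn 1)) ?Dalpha_ge0 //.
    rewrite (Dalpha_sqr sym).2 e2 e3 !exprMn real_normK ?num_real // -/H -/b.
    by apply/eqP; ring.
  by rewrite h; field; rewrite N0 N1.
have [eps [adm bD]] : exists eps, admissible_sign H eps /\
    b = - ((N - 1) / N * eps * D).
  rewrite /admissible_sign; have [H0|H0] := eqVneq H 0.
    case: (leP 0 b) => b0.
      exists (-1); split; [by right | rewrite -{1}(ger0_norm b0) bE; ring].
    exists 1; split; [by left | rewrite -[b]opprK -(ltr0_norm b0) bE; ring].
  exists (Num.sg H); split=> //; apply: (mulIf H0).
  have -> : b * H = - ((N - 1) / N * (`|H| * D)).
    by apply/eqP; rewrite -addr_eq0; apply/eqP.
  by rewrite (normrEsg H); ring.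
have AiiE : A i0 i0 = lambda_alpha eps A.
  by rewrite /lambda_alpha root_alphaE -/H -/D -[LHS](subrK H) -/b bD; ring.
have A0j j : j != i0 -> A i0 j = 0.
  move=> j0; apply/eqP; rewrite -sqrf_eq0; apply/eqP.
  by apply: (psumr_eq0P _ e2) => // k _; exact: sqr_ge0.
have tE : rest_trace A / (N - 1) = mu_alpha eps A.
  have -> : rest_trace A = N * H - A i0 i0 by rewrite /H trace_split; ring.
  by rewrite AiiE /lambda_alpha /mu_alpha root_alphaE -/H -/D; field; rewrite N0 N1.
have Ajk j k : j != i0 -> k != i0 -> A j k = (j == k)%:R * mu_alpha eps A.
  move=> j0 k0; apply/eqP; rewrite -subr_eq0 -sqrf_eq0 -tE; apply/eqP.
  move: k k0; apply: psumr_eq0P => [k _|]; first exact: sqr_ge0.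
  apply: (psumr_eq0P _ e3) => // l _; apply: sumr_ge0 => k _; exact: sqr_ge0.
exists eps; split=> //; apply/matrixP => k l; rewrite mxE.
have [<-|kl] := eqVneq k l.
  by have [->|k0] := eqVneq k i0; rewrite // Ajk // eqxx mul1r.
have [k0|k0] := eqVneq k i0.
  by rewrite k0 A0j // -k0 eq_sym.
have [l0|l0] := eqVneq l i0; first by rewrite sym l0 A0j.
by rewrite Ajk // (negPf kl) mul0r.
Qed.

Section Family.
Context {I : finType} (A : I -> 'M[R]_n).
Hypothesis sym : forall al j k, A al j k = A al k j.
Variable (normH : R).
Hypothesis normHE : normH = Num.sqrt (\sum_al Halpha (A al) ^+ 2).

Lemma calH_sum_excess :
  \sum_al calH (n := n) `|Halpha (A al)| (sqnorm_mx (A al))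
  - calH (n := n) normH (\sum_al sqnorm_mx (A al))
  = (N - 2) * ((N - 1) / N) *
    (Num.sqrt (\sum_al `|Halpha (A al)| ^+ 2) * Num.sqrt (\sum_al Dalpha (A al) ^+ 2)
      - \sum_al `|Halpha (A al)| * Dalpha (A al)).
Proof.
have N2 := N_ge2.
have N1 : N - 1 != 0 by lra.
have N0 : N != 0 by lra.
set hs := \sum_al Halpha (A al) ^+ 2.
have hs0 : 0 <= hs by exact: sum_sqr_ge0.
have -> : \sum_al `|Halpha (A al)| ^+ 2 = hs.
  by apply: eq_bigr => al _; rewrite real_normK ?num_real.
have dsE : \sum_al Dalpha (A al) ^+ 2
    = N * (\sum_al sqnorm_mx (A al) - N * hs) / (N - 1).
  transitivity (\sum_al N * (sqnorm_mx (A al) - N * Halpha (A al) ^+ 2) / (N - 1)).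
    by apply: eq_bigr => al _; rewrite (Dalpha_sqr (sym al)).1.
  by rewrite -mulr_suml -mulr_sumr sumrB -mulr_sumr.
rewrite /calH normHE sqr_sqrtr // -/hs -dsE -mulr_sumr.
rewrite (eq_bigr (fun al => 2 * N * Halpha (A al) ^+ 2 - sqnorm_mx (A al)
   - (N - 2) * (`|Halpha (A al)| * Dalpha (A al)))); last first.
  by move=> al _; rewrite real_normK ?num_real // -/(Dalpha _); ring.
by rewrite !sumrB -!mulr_sumr -/hs; field.
Qed.

Lemma calH_sum_le :
  calH (n := n) normH (\sum_al sqnorm_mx (A al)) <=
  \sum_al calH (n := n) `|Halpha (A al)| (sqnorm_mx (A al)).
Proof.
have N2 := N_ge2.
rewrite -subr_ge0 calH_sum_excess; apply: mulr_ge0.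
  by apply: mulr_ge0; [|apply: divr_ge0]; lra.
by rewrite subr_ge0 cauchy_schwarz_sqrt.
Qed.

Lemma sum_ricci_mx_ge :
  calH (n := n) normH (\sum_al sqnorm_mx (A al)) <= \sum_al ricci_mx (A al).
Proof.
apply: (le_trans calH_sum_le).
by apply: ler_sum => al _; exact: ricci_mx_ge.
Qed.

(** Equality holds if and only if it holds in the bound for each matrix and in
    [calH_sum_le], that is, in the Cauchy-Schwarz inequality.  When all the
    h_alpha vanish the latter is 0 = 0 and imposes no proportionality. *)
Lemma sum_ricci_mx_eq : (3 <= n)%N ->
  \sum_al ricci_mx (A al) = calH (n := n) normH (\sum_al sqnorm_mx (A al)) <->
  (forall al, special_mx (A al)) /\
  (normH != 0 -> exists rho : R, 0 <= rho /\
     forall al, Dalpha (A al) = rho * `|Halpha (A al)|).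
Proof.
move=> hn3; have N3 : 3 <= N by rewrite ler_nat.
set hs := \sum_al Halpha (A al) ^+ 2.
have hs0 : 0 <= hs by exact: sum_sqr_ge0.
have hsE : \sum_al `|Halpha (A al)| ^+ 2 = hs.
  by apply: eq_bigr => al _; rewrite real_normK ?num_real.
have nH0 : (normH != 0) = (hs != 0).
  by rewrite normHE -/hs sqrtr_eq0 -ltNge lt_def hs0 andbT.
have cs : (N - 2) * ((N - 1) / N) != 0.
  by rewrite !mulf_neq0 ?invr_eq0 //; lra.
have step2 : \sum_al calH (n := n) `|Halpha (A al)| (sqnorm_mx (A al))
   = calH (n := n) normH (\sum_al sqnorm_mx (A al)) <->
   (normH != 0 -> exists rho : R, 0 <= rho /\
     forall al, Dalpha (A al) = rho * `|Halpha (A al)|).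
  have [hs00|hsn0] := eqVneq hs 0.
    split=> _; first by rewrite nH0 hs00 eqxx.
    apply/eqP; rewrite -subr_eq0 calH_sum_excess hsE hs00 sqrtr0 mul0r big1 ?subr0 ?mulr0 //.
    by move=> al _; rewrite (sum_sqr_eq0 hs00) normr0 mul0r.
  have hsn0' : \sum_al `|Halpha (A al)| ^+ 2 != 0 by rewrite hsE.
  have [cs1 cs2] := cauchy_schwarz_sqrt_eq
    (fun al => normr_ge0 (Halpha (A al))) (fun al => Dalpha_ge0 (A al)) hsn0'.
  split=> [/eqP|].
    rewrite -subr_eq0 calH_sum_excess mulf_eq0 (negPf cs) subr_eq0 => /eqP /esym /cs1 h _.
    exact: h.
  rewrite nH0 => /(_ hsn0) /cs2 h.
  by apply/eqP; rewrite -subr_eq0 calH_sum_excess h subrr mulr0.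
split.
  move=> E; have le1 : forall al, true ->
    calH (n := n) `|Halpha (A al)| (sqnorm_mx (A al)) <= ricci_mx (A al).
    by move=> al _; exact: ricci_mx_ge.

  have E1 : \sum_al calH (n := n) `|Halpha (A al)| (sqnorm_mx (A al)) =
    \sum_al ricci_mx (A al).
    by apply/eqP; rewrite eq_le (ler_sum _ le1) E calH_sum_le.
  split; last by apply/step2; rewrite E1.
  move=> al; apply/ricci_mx_eq => //; apply/eqP; rewrite -subr_eq0; apply/eqP.
  move: al (isT : true); apply: psumr_eq0P.
    by move=> al _; rewrite subr_ge0 le1.
  by rewrite sumrB E1 subrr.
case=> h1 /step2 <-; apply: eq_bigr => al _; apply/ricci_mx_eq => //.
Qed.

End Family.
End MatrixInequality.

(** * The Ricci curvature at a point *)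

(** At a single point the argument is linear algebra: [b] and [bM] are the
    ambient and induced metrics, [df] the differential of the immersion, and
    the geometry enters through the Gauss equation and the curvature formulas
    taken as hypotheses. *)
Section AtPoint.
Context {R : realType} {n d : nat} (hn : (2 <= n)%N).
Variables (b : 'rV[R]_d -> 'rV[R]_d -> R) (bM : 'rV[R]_n -> 'rV[R]_n -> R)
  (df : 'rV[R]_n -> 'rV[R]_d) (sigma : 'rV[R]_n -> 'rV[R]_n -> 'rV[R]_d).
Hypotheses (b_lin : forall u, scalar (b u)) (b_sym : forall u v, b u v = b v u)
  (b_pos : forall u, u != 0 -> 0 < b u u)
  (bME : forall u v, bM u v = b (df u) (df v))
  (sigma_sym : forall u v, sigma u v = sigma v u)
  (sigma_normal : forall u v w, b (sigma u v) (df w) = 0).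
Variables (e : 'I_n -> 'rV[R]_n) (nu : 'I_(d - n) -> 'rV[R]_d).
Hypotheses (e_ortho : orthonormal_family bM e) (nu_ortho : orthonormal_family b nu)
  (nu_normal : forall al u, b (nu al) (df u) = 0).

Local Notation i0 := (first hn).
Local Notation A := (fun al => sigma_mx b sigma e (nu al)).
Local Notation H := (mean_curvature sigma e).

Let b_linl y : linear (b ^~ y : 'rV[R]_d -> R^o).
Proof. by move=> c u v; rewrite !(b_sym _ y) b_lin. Qed.

Let frame (k : 'I_n + 'I_(d - n)) : 'rV[R]_d :=
  match k with inl k => df (e k) | inr al => nu al end.

Let frame_ortho k l : b (frame k) (frame l) = (k == l)%:R.
Proof.
case: k l => [k|al] [l|be] /=.
- by rewrite -bME; exact: e_ortho.
- by rewrite b_sym nu_normal.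
- by rewrite nu_normal.
- exact: nu_ortho.
Qed.

(** The images of the tangent frame together with the normal frame are d
    orthonormal vectors, hence a basis; there n <= d because the images of the
    tangent frame are independent. *)
Lemma normal_parseval xi eta : (forall u, b xi (df u) = 0) ->
  b xi eta = \sum_al b xi (nu al) * b eta (nu al).
Proof.
move=> xi_normal.
have cardn : (n <= d)%N.
  have := orthonormal_card (b := b) b_linl (E := fun k => df (e k)).
  rewrite card_ord; apply=> k l; exact: (frame_ortho (inl k) (inl l)).
have cardI : #|{: 'I_n + 'I_(d - n)}| = d by rewrite card_sum !card_ord subnKC.
rewrite {1}(orthonormal_expansion b_linl frame_ortho cardI xi) big_sumType /=.
rewrite big1 ?add0r => [|k _]; last by rewrite xi_normal scale0r.
rewrite (linear_fun_sum (b_linl eta)); apply: eq_bigr => al _.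
by rewrite (linear_funZ (b_linl eta)) (b_sym (nu al)).
Qed.

Lemma sum_sigma : \sum_i sigma (e i) (e i) = n%:R *: H.
Proof.
have N0 : n%:R != 0 :> R by rewrite pnatr_eq0 -lt0n (leq_trans _ hn).
by rewrite /mean_curvature scalerA divff // scale1r.
Qed.

Lemma mean_curvature_normal w : b H (df w) = 0.
Proof.
rewrite /mean_curvature (linear_funZ (b_linl _)) (linear_fun_sum (b_linl _)).
by rewrite big1 ?scaler0.
Qed.

Lemma HalphaE al : Halpha (A al) = b H (nu al).
Proof.
rewrite /Halpha /mean_curvature (linear_funZ (b_linl _)) (linear_fun_sum (b_linl _)).
by congr (_ * _); apply: eq_bigr => i _; rewrite mxE.
Qed.

Lemma mean_curvature_sqr : b H H = \sum_al Halpha (A al) ^+ 2.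
Proof.
rewrite (normal_parseval _ mean_curvature_normal); apply: eq_bigr => al _.
by rewrite HalphaE.
Qed.

Lemma mean_curvature_norm_eq0 : (Num.sqrt (b H H) != 0) = (H != 0).
Proof.
have [->|H0] := eqVneq H 0; first by rewrite (linear_fun0 (b_lin _)) sqrtr0 eqxx.
by rewrite sqrtr_eq0 -ltNge b_pos.
Qed.

Lemma sigma_mx_sym al j k : A al j k = A al k j.
Proof. by rewrite !mxE sigma_sym. Qed.

Variables (c : R) (J : 'rV[R]_d -> 'rV[R]_d)
  (Ramb Cv_amb : 'rV[R]_d -> 'rV[R]_d -> 'rV[R]_d -> 'rV[R]_d)
  (Cv : 'rV[R]_n -> 'rV[R]_n -> 'rV[R]_n -> 'rV[R]_n)
  (s : 'rV[R]_d -> 'rV[R]_d -> R) (phi : 'rV[R]_d -> R)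
  (Ptan : 'rV[R]_n) (Pnor : 'rV[R]_d).
Hypotheses (JK : forall u, J (J u) = - u) (J_iso : forall u v, b (J u) (J v) = b u v)
  (space_form : forall u v w z, b (Ramb u v w) z =
     c * (b u z * b v w - b u w * b v z + b (J u) z * b (J v) w
         - b (J u) w * b (J v) z - 2 * b (J u) v * b (J w) z))
  (semi_sym : forall u v w, Cv_amb u v w = Ramb u v w + s u w *: v - s v w *: u)
  (gauss : forall u v w z, bM (Cv u v w) z =
     b (Cv_amb (df u) (df v) (df w)) (df z)
     + b (sigma v w) (sigma u z) - b (sigma u w) (sigma v z)
     - phi (sigma v w) * bM u z + phi (sigma u w) * bM v z)
  (phiE : forall u, phi u = b (df Ptan + Pnor) u).

Lemma J_skew u v : b (J u) v = - b (J v) u.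
Proof. by rewrite -J_iso JK (linear_funN (b_linl _)) b_sym. Qed.

Lemma J_diag u : b (J u) u = 0.
Proof. by have := J_skew u u; lra. Qed.

(** The space form term is c (1 + 3 g(J e_1, e_j) ^ 2) by skew-symmetry of J,
    and phi reduces to the pairing with the normal part of P on normal
    vectors. *)
Lemma sectional_term j : j != i0 ->
  bM (Cv (e i0) (e j) (e j)) (e i0) =
  c + 3 * c * b (J (df (e i0))) (df (e j)) ^+ 2 - s (df (e j)) (df (e j))
  - b Pnor (sigma (e j) (e j))
  + \sum_al (A al i0 i0 * A al j j - A al i0 j ^+ 2).
Proof.
move=> j0; rewrite gauss semi_sym.
have E0 : b (df (e i0)) (df (e i0)) = 1 by rewrite (frame_ortho (inl i0) (inl i0)) eqxx.
have Ej : b (df (e j)) (df (e j)) = 1 by rewrite (frame_ortho (inl j) (inl j)) eqxx.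
have E0j : b (df (e i0)) (df (e j)) = 0.
  by rewrite (frame_ortho (inl i0) (inl j)) (inj_eq inl_inj) eq_sym (negPf j0).
have Ej0 : b (df (e j)) (df (e i0)) = 0 by rewrite b_sym.
rewrite (linear_funB (b_linl _)) (linear_funD (b_linl _)) !(linear_funZ (b_linl _)).
rewrite /GRing.scale /= space_form !bME E0 Ej E0j Ej0 !J_diag.
rewrite (J_skew (df (e j))) phiE (linear_funD (b_linl _)).
rewrite [b (df Ptan) _]b_sym sigma_normal.
rewrite (normal_parseval _ (sigma_normal (e j) (e j))).
rewrite (normal_parseval _ (sigma_normal (e i0) (e j))).
have -> : \sum_al (A al i0 i0 * A al j j - A al i0 j ^+ 2) =
   \sum_al b (sigma (e j) (e j)) (nu al) * b (sigma (e i0) (e i0)) (nu al)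
   - \sum_al b (sigma (e i0) (e j)) (nu al) * b (sigma (e j) (e i0)) (nu al).
  rewrite -sumrB; apply: eq_bigr => al _.
  by rewrite !mxE (sigma_sym (e j) (e i0)); ring.
ring.
Qed.

Lemma ricci_decomposition :
  ricci bM Cv e i0 =
  (n%:R - 1) * c + 3 * c * (\sum_k b (J (df (e i0))) (df (e k)) ^+ 2)
  - \sum_k s (df (e k)) (df (e k)) + s (df (e i0)) (df (e i0))
  - n%:R * b Pnor H + b Pnor (sigma (e i0) (e i0)) + \sum_al ricci_mx hn (A al).
Proof.
have sqE : \sum_k b (J (df (e i0))) (df (e k)) ^+ 2 =
    \sum_(j | j != i0) b (J (df (e i0))) (df (e j)) ^+ 2.
  by rewrite (bigD1 i0) //= J_diag expr0n add0r.
have lambdaE : \sum_k s (df (e k)) (df (e k)) = s (df (e i0)) (df (e i0))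
    + \sum_(j | j != i0) s (df (e j)) (df (e j)) by rewrite (bigD1 i0).
have traceHE : n%:R * b Pnor H = b Pnor (sigma (e i0) (e i0))
    + \sum_(j | j != i0) b Pnor (sigma (e j) (e j)).
  apply: etrans (esym (linear_funZ (b_lin Pnor) n%:R H)) _.
  by rewrite -sum_sigma (linear_fun_sum (b_lin _)) (bigD1 i0).
rewrite sqE lambdaE traceHE /ricci (eq_bigr _ sectional_term) !big_split /=.
rewrite !sumrN -mulr_sumr (sum_rest_const hn) exchange_big /= /ricci_mx; ring.
Qed.

End AtPoint.

Theorem theorem4p6 (R : realType) (n m : nat) (hn : (2 <= n)%N)
    (M : manifold R n) (N : manifold R (2 * m)) (c : R)
    (g : form2 N) (LC : christoffel N) (J : endo N)
    (phi : form1 N) (P : vfield N)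
    (f : M -> N) (gM : form2 M) (D : christoffel M)
    (hg : is_metric g)
    (hLC : is_levi_civita g LC)
    (hN : is_complex_space_form g LC J c)
    (hphi : is_form1 phi)
    (hP : is_dual_field g phi P)
    (hf : is_immersion f)
    (hgM : is_metric gM)
    (hiso : is_isometric f gM g)
    (hD : is_induced_connection f g (semi_symmetric LC phi) D)
    (x : M) (i : mchart M) (a : mchart N)
    (hi : mdom i x) (ha : mdom a (f x)) :
  let p := mcoord i x in
  let q := mcoord a (f x) in
  let df : 'rV[R]_n -> 'rV[R]_(2 * m) := fun u => 'D_u (lrep f i a) p in
  let gq := g a q in
  let sigma := second_ff f (semi_symmetric LC phi) D i a p in
  let s := s_tensor LC phi a q in
  forall (X : 'rV[R]_n) (e : 'I_n -> 'rV[R]_n)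
    (nu : 'I_(2 * m - n) -> 'rV[R]_(2 * m))
    (Ptan : 'rV[R]_n) (Pnor : 'rV[R]_(2 * m)),
  gM i p X X = 1 ->
  orthonormal_family (gM i p) e -> e (first hn) = X ->
  orthonormal_family gq nu -> (forall al u, gq (nu al) (df u) = 0) ->
  P a q = df Ptan + Pnor -> (forall u, gq Pnor (df u) = 0) ->
  let A := fun al => sigma_mx gq sigma e (nu al) in
  let H := mean_curvature sigma e in
  let normH := Num.sqrt (gq H H) in
  let sqnorm_sigma := \sum_al sqnorm_mx (A al) in
  let sqnorm_TX := \sum_k gq (J a q (df X)) (df (e k)) ^+ 2 in
  let lambda := \sum_k s (df (e k)) (df (e k)) in
  let RicX := ricci (gM i p) (curv (D i) p) e (first hn) in
  let bound :=
    (n%:R - 1) * c + 3 * c * sqnorm_TX - lambda + s (df X) (df X)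
    - n%:R * gq Pnor H + gq Pnor (sigma X X)
    + calH (n := n) normH sqnorm_sigma in
  RicX >= bound /\
  ((3 <= n)%N ->
   (RicX = bound <->
    (forall al, exists eps : R,
       admissible_sign (Halpha (A al)) eps /\
       A al = \matrix_(k, l)
         (if k == l then
            if k == first hn then lambda_alpha eps (A al)
            else mu_alpha eps (A al)
          else 0)) /\
    (H != 0 -> exists rho : R, 0 <= rho /\
       forall al, Dalpha (A al) = rho * `|Halpha (A al)|))).
Proof.
move=> p q df gq sigma s X e nu Ptan Pnor _ he eX hnu hnun PE _ A H normH
  sqnorm_sigma sqnorm_TX lambda RicX bound.
have shift_le (y w t : R) : w <= t -> y <= y - w + t by lra.
have shift_eq (y w t : R) : y - w + t = y <-> t = w by split=> ?; lra.
have Up : lrep_dom f i a p by exists x.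
have Fp : lrep f i a p = q by rewrite /lrep /= (m_coordK hi).
have aq : mrange a q by exists (f x).
have b_lin u : scalar (gq u) := metric_linr hg u aq.
have b_sym u v : gq u v = gq v u := metric_sym hg u v aq.
have b_pos u : u != 0 -> 0 < gq u u.
  by case: hg => _ _ h _ _; exact: h.
have bME u v : gM i p u v = gq (df u) (df v).
  by have := hiso i a p u v Up; rewrite Fp.
have sigma_sym u v : sigma u v = sigma v u.
  exact: (second_ff_sym hg hLC hf hD u v Up).
have sigma_normal u v w : gq (sigma u v) (df w) = 0.
  by have := second_ff_normal hD u v w Up; rewrite Fp.
have [[_ JK0 Jiso0 _] sf0] := hN.
have JK u : J a q (J a q u) = - u := JK0 a q u aq.
have Jiso u v : gq (J a q u) (J a q v) = gq u v := Jiso0 a q u v aq.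
have sf u v w z := sf0 a q u v w z aq.
have semi u v w := curv_semi_symmetric hLC hphi u v w aq.
have gauss u v w z : gM i p (curv (D i) p u v w) z =
     gq (curv (semi_symmetric LC phi a) q (df u) (df v) (df w)) (df z)
     + gq (sigma v w) (sigma u z) - gq (sigma u w) (sigma v z)
     - phi a q (sigma v w) * gM i p u z + phi a q (sigma u w) * gM i p v z.
  by have := gauss_submanifold hg hLC hphi hf hiso hD u v w z Up; rewrite Fp.
have phiE u : phi a q u = gq (df Ptan + Pnor) u by rewrite -PE; exact: esym (hP a q u aq).
have RicE : RicX = bound - calH (n := n) normH sqnorm_sigma
    + \sum_al ricci_mx hn (A al).
  rewrite /bound addrK /sqnorm_TX -eX.
  exact: (ricci_decomposition hn b_lin b_sym bME sigma_sym sigma_normal he hnu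
    hnun JK Jiso sf semi gauss phiE).
have A_sym := sigma_mx_sym gq sigma_sym e nu : forall al j k, A al j k = A al k j.
have normHE : normH = Num.sqrt (\sum_al Halpha (A al) ^+ 2).
  by rewrite /normH (mean_curvature_sqr b_lin b_sym bME sigma_normal he hnu hnun).
have normH0 : (normH != 0) = (H != 0) := mean_curvature_norm_eq0 sigma b_lin b_pos e.
split=> [|hn3]; rewrite RicE.
  by apply: shift_le; exact: sum_ricci_mx_ge.
apply: iff_trans (shift_eq _ _ _) _; rewrite -normH0.
exact: sum_ricci_mx_eq.
Qed.
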